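(* Let $m$ and $k$ be positive integers. Then $\psi_{2m}(\sqrt{k})\in\pi^{2m}\mathbb{Q}$.
   Context: The secant Dirichlet series is $\psi_s(\tau)=\sum_{n=1}^{\infty}\frac{\sec(\pi n\tau)}{n^s}$; here it is evaluated at the real number $\tau=\sqrt{k}$, where for $s\ge 2$ the series converges (absolutely, when $\sqrt k$ is irrational). *)

(* Defs.v *)
(* Stdlib reals with Coquelicot series. *)
From Stdlib Require Import Reals QArith Qreals.
From Coquelicot Require Import Coquelicot.
Open Scope R_scope.

Definition sec (x : R) : R := / cos x.

(** The series runs over n >= 1 while Coquelicot's start at 0, hence the shift
    to [S n].  When [cos (PI * n * tau) = 0] for some n >= 1 (tau rational with
    even denominator) the series is undefined and the value below is
    meaningless; tau = sqrt k, with k a positive integer, is never such a point. *)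
Definition psi_term (s : nat) (tau : R) (n : nat) : R :=
  sec (PI * INR (S n) * tau) / INR (S n) ^ s.

(** [Series] is total: this is the sum only when the terms are summable. *)
Definition psi (s : nat) (tau : R) : R := Series (psi_term s tau).

(* Main.v *)
Require Import Defs.
From Stdlib Require Import Reals QArith Qreals.
From Coquelicot Require Import Coquelicot.
From Stdlib Require Import Lra Lia Psatz ZArith List Classical.
Open Scope R_scope.

(** Let [chi] be the odd character modulo 4 and [y = 1 + 2 x]. Up to the factor [PI / 2],
    [psi (2 m) x] is the double sum over [n >= 1] and [p] of [chi (p - n) / (n^(2m) (p - n y))], by
    the partial fractions of the secant, and exchanging the roles of [n] and [p] turns [y] into
    [1 / y], that is [x] into [- x / (1 + 2 x)]. In [(y^(2m) / p^(2m) - 1 / n^(2m)) / (p - n y)] the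
    denominator [p - n y] cancels, so on a box [n, p <= 2L] the difference of the two double sums is
    a combination of products of partial sums of the values at odd integers of [L(chi, .)] and at
    even integers of the alternating zeta function, which are rational up to powers of [PI].
    Dominated convergence applies because [cos (PI n x)] times a truncated inner sum is an
    integral against a Dirichlet kernel, bounded uniformly in all parameters, and because
    [sum_n |sec (PI n x)| / n^2] converges when [x] is badly approximable. Hence [psi (2 m)] is
    quasi-modular for [x -> x + 2], [x -> - x] and [x -> x / (1 + 2 x)]. A power of a Pell unit
    gives a product of these maps fixing both [sqrt k] and [- sqrt k], so that
    [psi (2 m) r = PI^(2m) (a + b r)] for both roots [r], with [a] and [b] rational; as [psi] is
    even, [b = 0]. For a perfect square [k], the value is a zeta or an alternating zeta value. *)

(** * Finite sums and dominated convergence *)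

(** The sum over [p] converges only conditionally, so the double sum cannot be reordered freely. The
    algebra is therefore done on a finite square box, which the exchange of [n] and [p] preserves,
    and a single limit is taken afterwards. The terms with [p = 0] cannot enter the box because of
    the factor [1 / p]; put back for the limit, they produce the term in [y^(2m) - 1 / y] of the
    functional equation. The integer values needed, [L(chi, 1)] included, come from the same
    kernels: tested on even powers of [t], these give a recursion free of Bernoulli and Euler
    numbers. In the last part every identity is required at both square roots of [k] with the same
    rational coefficients: at [sqrt k] alone one would only get a value in [Q(sqrt k)], and evenness
    could not remove its irrational part. The maps at hand give matrices congruent to the identity
    modulo 2, which is why the Pell unit has to be squared; since the result is neither 1 nor -1,
    the fixed point equation can be solved for [psi]. *)

Fixpoint psum (f : nat -> R) (N : nat) : R :=
  match N with O => 0 | S N' => psum f N' + f N end.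

Lemma psum_ext (f g : nat -> R) (N : nat) :
  (forall n, (1 <= n <= N)%nat -> f n = g n) -> psum f N = psum g N.
Proof.
  induction N as [|N IH]; intros H; simpl; [reflexivity|].
  rewrite IH; [rewrite H by lia; reflexivity|intros n Hn; apply H; lia].
Qed.

Lemma psum_le (f g : nat -> R) (N : nat) :
  (forall n, (1 <= n <= N)%nat -> f n <= g n) -> psum f N <= psum g N.
Proof.
  induction N as [|N IH]; intros H; simpl; [lra|].
  apply Rplus_le_compat; [apply IH; intros n Hn|]; apply H; lia.
Qed.

Lemma psum_plus (f g : nat -> R) (N : nat) :
  psum (fun n => f n + g n) N = psum f N + psum g N.
Proof. induction N as [|N IH]; simpl; [lra|rewrite IH; lra]. Qed.

Lemma psum_scal (c : R) (f : nat -> R) (N : nat) :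
  psum (fun n => c * f n) N = c * psum f N.
Proof. induction N as [|N IH]; simpl; [lra|rewrite IH; lra]. Qed.

Lemma psum_zero (f : nat -> R) (N : nat) :
  (forall n, (1 <= n <= N)%nat -> f n = 0) -> psum f N = 0.
Proof.
  intros H. rewrite (psum_ext f (fun n => 0 * 0)), psum_scal; [lra|].
  intros n Hn. rewrite H by assumption. lra.
Qed.

Lemma psum_swap (f : nat -> nat -> R) (M N : nat) :
  psum (fun i => psum (f i) M) N = psum (fun j => psum (fun i => f i j) N) M.
Proof.
  induction N as [|N IH]; simpl.
  - symmetry. now apply psum_zero.
  - rewrite IH, <- psum_plus. reflexivity.
Qed.

Lemma psum_mult (f g : nat -> R) (M N : nat) :
  psum (fun i => psum (fun j => f i * g j) M) N = psum f N * psum g M.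
Proof.
  rewrite (psum_ext _ (fun i => psum g M * f i)), psum_scal; [lra|].
  intros i _. rewrite psum_scal. lra.
Qed.

Lemma psum_pairs (f : nat -> R) (L : nat) :
  psum f (2 * L) = psum (fun l => f (2 * l - 1)%nat) L + psum (fun l => f (2 * l)%nat) L.
Proof.
  induction L as [|L IH]; [simpl; lra|].
  replace (2 * S L)%nat with (S (S (2 * L))) by lia.
  cbn [psum]. rewrite IH.
  replace (2 * S L - 1)%nat with (S (2 * L)) by lia.
  replace (2 * S L)%nat with (S (S (2 * L))) by lia. lra.
Qed.

Lemma psum_diff_abs (f b : nat -> R) (M N : nat) :
  (M <= N)%nat -> (forall n, (1 <= n)%nat -> Rabs (f n) <= b n) ->
  Rabs (psum f N - psum f M) <= psum b N - psum b M.
Proof.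
  intros HMN H. induction HMN as [|N HMN IH].
  - rewrite !Rminus_diag, Rabs_R0. lra.
  - cbn [psum].
    replace (psum f N + f (S N) - psum f M) with ((psum f N - psum f M) + f (S N)) by lra.
    eapply Rle_trans; [apply Rabs_triang|].
    specialize (H (S N) ltac:(lia)). lra.
Qed.

Lemma sum_n_psum (f : nat -> R) (N : nat) :
  sum_n (fun n => f (S n)) N = psum f (S N).
Proof.
  induction N as [|N IH].
  - rewrite sum_O. simpl. lra.
  - rewrite sum_Sn, IH. reflexivity.
Qed.

Lemma is_series_psum (f : nat -> R) (l : R) :
  is_series (fun n => f (S n)) l <-> is_lim_seq (psum f) l.
Proof.
  split; intros H.
  - apply is_lim_seq_incr_1. eapply is_lim_seq_ext; [apply sum_n_psum|]. exact H.
  - apply is_lim_seq_incr_1 in H.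
    eapply is_lim_seq_ext in H; [|intros n; symmetry; apply (sum_n_psum f)]. exact H.
Qed.

Lemma is_lim_seq_double (u : nat -> R) (l : R) :
  is_lim_seq u l -> is_lim_seq (fun L => u (2 * L)%nat) l.
Proof.
  intros H. apply (is_lim_seq_subseq u l (fun L => (2 * L)%nat)); [|exact H].
  apply eventually_subseq. intros n. lia.
Qed.

Lemma is_lim_seq_psum (f : nat -> nat -> R) (g : nat -> R) (N : nat) :
  (forall n, (1 <= n <= N)%nat -> is_lim_seq (fun L => f L n) (g n)) ->
  is_lim_seq (fun L => psum (f L) N) (psum g N).
Proof.
  induction N as [|N IH]; intros H; cbn [psum].
  - apply is_lim_seq_const.
  - apply is_lim_seq_plus'; [apply IH; intros n Hn|]; apply H; lia.
Qed.

Lemma ex_series_bounded_psum (f : nat -> R) (B : R) :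
  (forall n, (1 <= n)%nat -> 0 <= f n) -> (forall N, psum f N <= B) ->
  ex_series (fun n => f (S n)).
Proof.
  intros Hf HB.
  destruct (ex_finite_lim_seq_incr (psum f) B) as [l Hl].
  - intros n. cbn [psum]. specialize (Hf (S n) ltac:(lia)). lra.
  - exact HB.
  - exists l. now apply is_series_psum.
Qed.

(** Tannery's theorem with a cutoff that grows with the parameter: the head up to [N0] converges
    termwise, and what lies between [N0] and [2 L] is bounded by the tail of [b]. *)
Lemma tannery (f : nat -> nat -> R) (g b : nat -> R) :
  (forall L n, (1 <= n)%nat -> Rabs (f L n) <= b n) ->
  ex_series (fun n => b (S n)) ->
  (forall n, (1 <= n)%nat -> is_lim_seq (fun L => f L n) (g n)) ->
  is_lim_seq (fun L => psum (f L) (2 * L)) (Series (fun n => g (S n))).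
Proof.
  intros Hfb [B HB] Hlim.
  assert (Hgb : forall n, (1 <= n)%nat -> Rabs (g n) <= b n).
  { intros n Hn.
    apply (is_lim_seq_le (fun L => Rabs (f L n)) (fun _ => b n) (Rabs (g n)) (b n)).
    - intros L. now apply Hfb.
    - apply (is_lim_seq_abs _ (g n)). now apply Hlim.
    - apply is_lim_seq_const. }
  assert (Hg : is_lim_seq (psum g) (Series (fun n => g (S n)))).
  { apply is_series_psum, Series_correct.
    apply (ex_series_le (fun n => g (S n)) (fun n => b (S n))).
    - intros n. apply Hgb. lia.
    - now exists B. }
  apply is_series_psum in HB.
  assert (Hmono : forall M N, (M <= N)%nat -> psum b M <= psum b N).
  { intros M N HMN. pose proof (psum_diff_abs (fun _ => 0) b M N HMN) as H.
    assert (forall n, (1 <= n)%nat -> Rabs 0 <= b n) as H0.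
    { intros n Hn. rewrite Rabs_R0. eapply Rle_trans; [apply Rabs_pos|apply (Hgb n Hn)]. }
    specialize (H H0). pose proof (Rabs_pos (psum (fun _ => 0) N - psum (fun _ => 0) M)). lra. }
  assert (HbB : forall N, psum b N <= B).
  { intros N. apply (is_lim_seq_incr_compare (psum b)); [exact HB|].
    intros n. apply Hmono. lia. }
  apply is_lim_seq_spec. intros eps.
  pose proof (cond_pos eps) as He.
  assert (He4 : 0 < eps / 4) by lra.
  apply is_lim_seq_spec in HB. destruct (HB (mkposreal _ He4)) as [N1 HN1].
  apply is_lim_seq_spec in Hg. destruct (Hg (mkposreal _ He4)) as [N2 HN2].
  simpl in HN1, HN2. set (N0 := Nat.max N1 N2).
  pose proof (is_lim_seq_psum f g N0 (fun n Hn => Hlim n (proj1 Hn))) as Hfin.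
  apply is_lim_seq_spec in Hfin. destruct (Hfin (mkposreal _ He4)) as [N3 HN3].
  simpl in HN3. exists (Nat.max N0 N3). intros L HL.
  specialize (HN1 N0 ltac:(lia)). specialize (HN2 N0 ltac:(lia)). specialize (HN3 L ltac:(lia)).
  pose proof (psum_diff_abs (f L) b N0 (2 * L) ltac:(lia) (Hfb L)) as H1.
  pose proof (HbB (2 * L)%nat).
  apply Rabs_def2 in HN1. apply Rabs_def2 in HN2. apply Rabs_def2 in HN3.
  apply Rabs_le_between in H1. apply Rabs_def1; lra.
Qed.

(** * Dirichlet kernels *)

(** A weak Jordan inequality, from the Taylor polynomial of degree 7 and [PI <= 4]. The constant 1/3
    suffices: with [PI >= 3] it still gives [sin (PI t) >= t] on [[0, 1/2]]. *)
Lemma sin_ge_third (t : R) : 0 <= t <= PI / 2 -> t / 3 <= sin t.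
Proof.
  intros [Ht0 Ht1]. pose proof PI_4 as HPI.
  destruct (SIN t Ht0 ltac:(lra)) as [H _].
  eapply Rle_trans; [|exact H].
  unfold sin_lb, sin_approx, sin_term. simpl.
  assert (Ht : 0 <= t * t <= 4) by nra.
  set (u := t * t) in *.
  match goal with |- _ <= ?X => replace X with
    (t * (1 - u / 6 + u * u / 120 - u * u * u / 5040)) by (unfold u; field) end.
  assert (1 / 3 <= 1 - u / 6 + u * u / 120 - u * u * u / 5040) by nra.
  nra.
Qed.

Lemma Rabs_cos_diff (a b : R) : Rabs (cos a - cos b) <= Rabs (a - b).
Proof.
  destruct (MVT_abs cos (fun t => - sin t) b a) as [c [H _]].
  - intros c _. apply derivable_pt_lim_cos.
  - rewrite H, Rabs_Ropp. pose proof (Rabs_pos (a - b)).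
    assert (Rabs (sin c) <= 1) by (apply Rabs_le, SIN_bound). nra.
Qed.

Lemma ex_RInt_cont (f : R -> R) (a b : R) : (forall t, continuous f t) -> ex_RInt f a b.
Proof. intros H. apply (ex_RInt_continuous f). intros; apply H. Qed.

Lemma RInt_Rext (f g : R -> R) (a b : R) :
  (forall t, f t = g t) -> RInt f a b = RInt g a b :> R.
Proof. intros H. apply RInt_ext. intros t _. apply H. Qed.

Lemma continuous_Rmult (f g : R -> R) (t : R) :
  continuous f t -> continuous g t -> continuous (fun u => f u * g u) t.
Proof. intros Hf Hg. exact (continuous_mult f g t Hf Hg). Qed.

Lemma continuous_Rplus (f g : R -> R) (t : R) :
  continuous f t -> continuous g t -> continuous (fun u => f u + g u) t.
Proof. intros Hf Hg. exact (continuous_plus f g t Hf Hg). Qed.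

Lemma continuous_cos_scal (z t : R) : continuous (fun u => cos (z * u)) t.
Proof. apply (ex_derive_continuous (fun u => cos (z * u))). auto_derive. trivial. Qed.

Lemma continuous_psum (f : nat -> R -> R) (N : nat) (t : R) :
  (forall n, continuous (f n) t) -> continuous (fun u => psum (fun n => f n u) N) t.
Proof.
  intros H. induction N as [|N IH]; cbn [psum].
  - apply continuous_const.
  - now apply continuous_Rplus.
Qed.

Lemma RInt_psum (f : nat -> R -> R) (N : nat) (a b : R) :
  (forall n t, continuous (f n) t) ->
  RInt (fun t => psum (fun n => f n t) N) a b = psum (fun n => RInt (f n) a b) N.
Proof.
  intros H. induction N as [|N IH]; cbn [psum].
  - rewrite RInt_const. unfold scal; simpl; unfold mult; simpl. ring.
  - rewrite <- IH. apply (RInt_plus (V := R_CompleteNormedModule)).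
    + apply ex_RInt_cont. intros t. now apply continuous_psum.
    + now apply ex_RInt_cont.
Qed.

Lemma RInt_Rplus (f g : R -> R) (a b : R) :
  (forall t, continuous f t) -> (forall t, continuous g t) ->
  RInt (fun t => f t + g t) a b = RInt f a b + RInt g a b.
Proof.
  intros Hf Hg. apply (RInt_plus (V := R_CompleteNormedModule)); now apply ex_RInt_cont.
Qed.

Lemma RInt_Rscal (c : R) (f : R -> R) (a b : R) :
  (forall t, continuous f t) -> RInt (fun t => c * f t) a b = c * RInt f a b.
Proof.
  intros Hf. apply (RInt_scal (V := R_CompleteNormedModule)); now apply ex_RInt_cont.
Qed.

Lemma RInt_abs_le_const (f : R -> R) (a b M : R) :
  a <= b -> (forall t, continuous f t) -> (forall t, a <= t <= b -> Rabs (f t) <= M) ->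
  Rabs (RInt f a b) <= (b - a) * M.
Proof.
  intros Hab Hf HM. apply abs_RInt_le_const; [exact Hab|now apply ex_RInt_cont|exact HM].
Qed.

(** The exponential sum over [p = 2l - e], that is over all [|p| <= 2L - e] with [p = e] mod 2. *)
Definition dirichlet (e L : nat) (t : R) : R :=
  (1 - INR e) + psum (fun l => 2 * cos ((2 * INR l - INR e) * t)) L.

(** Telescoping by [2 cos a sin t = sin (a + t) - sin (a - t)]. *)
Lemma dirichlet_sin (e L : nat) (t : R) :
  (e <= 1)%nat -> dirichlet e L t * sin t = sin ((2 * INR L + 1 - INR e) * t).
Proof.
  intros He. unfold dirichlet. induction L as [|L IH]; cbn [psum].
  - assert (e = 0 \/ e = 1)%nat as [->| ->] by lia; simpl.
    + replace ((2 * 0 + 1 - 0) * t) with t by ring. ring.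
    + replace ((2 * 0 + 1 - 1) * t) with 0 by ring. rewrite sin_0. ring.
  - rewrite <- Rplus_assoc, Rmult_plus_distr_r, IH, S_INR.
    set (a := (2 * (INR L + 1) - INR e) * t).
    replace ((2 * INR L + 1 - INR e) * t) with (a - t) by (unfold a; ring).
    replace ((2 * (INR L + 1) + 1 - INR e) * t) with (a + t) by (unfold a; ring).
    rewrite sin_plus, sin_minus. ring.
Qed.

Lemma dirichlet_bound (e L : nat) (t : R) :
  (e <= 1)%nat -> 0 <= t <= PI / 2 -> t * Rabs (dirichlet e L t) <= 3.
Proof.
  intros He Ht. pose proof (dirichlet_sin e L t He) as H.
  apply (f_equal Rabs) in H. rewrite Rabs_mult in H.
  pose proof (sin_ge_third t Ht) as Hs. rewrite (Rabs_pos_eq (sin t)) in H by lra.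
  assert (Rabs (sin ((2 * INR L + 1 - INR e) * t)) <= 1) by (apply Rabs_le, SIN_bound).
  pose proof (Rabs_pos (dirichlet e L t)). nra.
Qed.

Lemma continuous_dirichlet (e L : nat) (t : R) : continuous (dirichlet e L) t.
Proof.
  apply continuous_Rplus; [apply continuous_const|].
  apply (continuous_psum (fun l t => 2 * cos ((2 * INR l - INR e) * t))). intros l.
  apply continuous_Rmult; [apply continuous_const|apply continuous_cos_scal].
Qed.

Lemma RInt_dirichlet (F : R -> R) (e L : nat) :
  (forall t, continuous F t) ->
  RInt (fun t => F t * dirichlet e L t) 0 (PI / 2) =
  (1 - INR e) * RInt F 0 (PI / 2) +
  psum (fun l => 2 * RInt (fun t => F t * cos ((2 * INR l - INR e) * t)) 0 (PI / 2)) L.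
Proof.
  intros HF.
  assert (Hc : forall l t, continuous (fun t => F t * cos ((2 * INR l - INR e) * t)) t).
  { intros l t. apply continuous_Rmult; [apply HF|apply continuous_cos_scal]. }
  rewrite <- RInt_Rscal by assumption.
  rewrite (psum_ext _ (fun l => RInt (fun t => 2 * (F t * cos ((2 * INR l - INR e) * t))) 0 (PI / 2))).
  2: { intros l _. symmetry. now apply (RInt_Rscal 2). }
  assert (Hc2 : forall l t, continuous (fun t => 2 * (F t * cos ((2 * INR l - INR e) * t))) t).
  { intros l t. apply continuous_Rmult; [apply continuous_const|apply Hc]. }
  rewrite <- RInt_psum by exact Hc2.
  rewrite <- RInt_Rplus.
  - apply RInt_Rext. intros t. unfold dirichlet.
    rewrite Rmult_plus_distr_l, <- psum_scal. f_equal; [ring|].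
    apply psum_ext. intros n _. ring.
  - intros t. apply continuous_Rmult; [apply continuous_const|apply HF].
  - intros t. apply (continuous_psum (fun l t => 2 * (F t * cos ((2 * INR l - INR e) * t)))).
    intros l; apply Hc2.
Qed.

Lemma RInt_cos (u : R) : u <> 0 -> RInt (fun t => cos (u * t)) 0 (PI / 2) = sin (u * (PI / 2)) / u :> R.
Proof.
  intros Hu. apply is_RInt_unique.
  replace (sin (u * (PI / 2)) / u) with (minus (sin (u * (PI / 2)) / u) (sin (u * 0) / u)).
  2: { unfold minus, plus, opp; simpl. rewrite Rmult_0_r, sin_0. unfold Rdiv. ring. }
  apply (is_RInt_derive (fun t => sin (u * t) / u) (fun t => cos (u * t))).
  - intros t _. auto_derive; [trivial|]. field. exact Hu.
  - intros t _. apply continuous_cos_scal.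
Qed.

Lemma RInt_cos_0 : RInt (fun t => cos (0 * t)) 0 (PI / 2) = PI / 2 :> R.
Proof.
  rewrite (RInt_Rext _ (fun _ => 1)).
  - rewrite RInt_const. unfold scal; simpl; unfold mult; simpl. lra.
  - intros t. rewrite Rmult_0_l. apply cos_0.
Qed.

Lemma RInt_cos_mul_cos (z p : R) :
  2 * RInt (fun t => cos (z * t) * cos (p * t)) 0 (PI / 2) =
  RInt (fun t => cos ((p - z) * t)) 0 (PI / 2) + RInt (fun t => cos ((p + z) * t)) 0 (PI / 2).
Proof.
  rewrite <- RInt_Rscal, <- RInt_Rplus; try (intros t; apply continuous_cos_scal).
  - apply RInt_Rext. intros t.
    rewrite Rmult_minus_distr_r, Rmult_plus_distr_r, cos_minus, cos_plus. ring.
  - intros t. apply continuous_Rmult; apply continuous_cos_scal.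
Qed.

Lemma sin_INR_PI (n : nat) : sin (INR n * PI) = 0.
Proof.
  induction n as [|n IH]; [simpl; now rewrite Rmult_0_l, sin_0|].
  rewrite S_INR, Rmult_plus_distr_r, Rmult_1_l, neg_sin, IH. ring.
Qed.

(** Integrated term by term, this is the sum of [sin ((p - z) PI / 2) / (p - z)] over
    [|p| <= 2L - e] with [p = e] mod 2: a truncated partial fraction expansion. *)
Definition kernel (e L : nat) (z : R) : R :=
  RInt (fun t => cos (z * t) * dirichlet e L t) 0 (PI / 2).

Lemma kernel_eq (e L : nat) (z : R) :
  kernel e L z = (1 - INR e) * RInt (fun t => cos (z * t)) 0 (PI / 2) +
  psum (fun l => RInt (fun t => cos ((2 * INR l - INR e - z) * t)) 0 (PI / 2) +
                 RInt (fun t => cos ((2 * INR l - INR e + z) * t)) 0 (PI / 2)) L.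
Proof.
  unfold kernel. rewrite RInt_dirichlet by (intros; apply continuous_cos_scal).
  f_equal. apply psum_ext. intros l _. apply RInt_cos_mul_cos.
Qed.

Lemma RInt_cos_even_pos (n : nat) :
  (1 <= n)%nat -> RInt (fun t => cos (2 * INR n * t)) 0 (PI / 2) = 0 :> R.
Proof.
  intros Hn. apply le_INR in Hn. simpl in Hn. rewrite RInt_cos by lra.
  replace (2 * INR n * (PI / 2)) with (INR n * PI) by field.
  rewrite sin_INR_PI. unfold Rdiv. ring.
Qed.

Lemma RInt_cos_opp (u : R) :
  RInt (fun t => cos (- u * t)) 0 (PI / 2) = RInt (fun t => cos (u * t)) 0 (PI / 2) :> R.
Proof.
  apply RInt_Rext. intros t. rewrite Ropp_mult_distr_l_reverse. apply cos_neg.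
Qed.

(** Orthogonality: at a frequency of the class itself all sums and differences of frequencies are
    even integers, and only the zero frequency has a nonzero integral on [[0, PI / 2]]. *)
Lemma kernel_at_index (e L i : nat) :
  (e <= i)%nat -> (e <= 1)%nat ->
  kernel e L (2 * INR i - INR e) = if Nat.leb i L then PI / 2 else 0.
Proof.
  intros Hei He. rewrite kernel_eq.
  induction L as [|L IH]; cbn [psum].
  - destruct (Nat.leb_spec i 0) as [Hi|Hi].
    + replace i with 0%nat by lia. replace e with 0%nat by lia. simpl.
      replace (2 * 0 - 0) with 0 by ring. rewrite RInt_cos_0. ring.
    + assert (e = 0 \/ e = 1)%nat as [->| ->] by lia; [|simpl; ring].
      replace (2 * INR i - INR 0) with (2 * INR i) by (simpl; ring).
      rewrite RInt_cos_even_pos by lia. ring.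
  - rewrite <- Rplus_assoc, IH.
    replace (2 * INR (S L) - INR e + (2 * INR i - INR e)) with (2 * INR (S L + i - e)).
    2: { rewrite minus_INR, plus_INR by lia. ring. }
    rewrite (RInt_cos_even_pos (S L + i - e)) by lia.
    replace (2 * INR (S L) - INR e - (2 * INR i - INR e)) with (2 * (INR (S L) - INR i)) by ring.
    destruct (Nat.leb_spec i L), (Nat.leb_spec i (S L)); try lia.
    + rewrite <- minus_INR, RInt_cos_even_pos by lia. ring.
    + replace i with (S L) by lia. rewrite Rminus_diag, Rmult_0_r, RInt_cos_0. ring.
    + replace (2 * (INR (S L) - INR i)) with (- (2 * INR (i - S L))).
      2: { rewrite minus_INR by lia. ring. }
      rewrite RInt_cos_opp, RInt_cos_even_pos by lia. ring.
Qed.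

Lemma continuous_cos_mul_dirichlet (e L : nat) (z t : R) :
  continuous (fun t => cos (z * t) * dirichlet e L t) t.
Proof. apply continuous_Rmult; [apply continuous_cos_scal|apply continuous_dirichlet]. Qed.

Lemma kernel_diff (e L : nat) (z w : R) :
  kernel e L z - kernel e L w =
  RInt (fun t => (cos (z * t) - cos (w * t)) * dirichlet e L t) 0 (PI / 2).
Proof.
  unfold kernel.
  replace (RInt (fun t => cos (z * t) * dirichlet e L t) 0 (PI / 2) -
           RInt (fun t => cos (w * t) * dirichlet e L t) 0 (PI / 2))
    with (RInt (fun t => cos (z * t) * dirichlet e L t) 0 (PI / 2) +
          (-1) * RInt (fun t => cos (w * t) * dirichlet e L t) 0 (PI / 2)) by ring.
  rewrite <- RInt_Rscal by apply continuous_cos_mul_dirichlet.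
  rewrite <- RInt_Rplus.
  - apply RInt_Rext. intros t. ring.
  - apply continuous_cos_mul_dirichlet.
  - intros t. apply continuous_Rmult; [apply continuous_const|apply continuous_cos_mul_dirichlet].
Qed.

(** Compare [z] with a frequency [w] of the class at distance at most 1, where the kernel is 0 or
    [PI / 2]. The difference of the cosines is at most [t], which compensates the bound [3 / t] of
    the Dirichlet kernel. *)
Lemma kernel_bound (e L : nat) (z : R) : (e <= 1)%nat -> Rabs (kernel e L z) <= 8.
Proof.
  intros He. pose proof PI_4 as HPI. pose proof PI_RGT_0.
  assert (Hz : kernel e L z = kernel e L (Rabs z)).
  { unfold kernel. apply RInt_Rext. intros t. f_equal.
    unfold Rabs. destruct (Rcase_abs z); [|reflexivity].
    rewrite Ropp_mult_distr_l_reverse. symmetry. apply cos_neg. }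
  rewrite Hz. clear Hz. pose proof (Rabs_pos z) as Hz. set (x := Rabs z) in *. clearbody x.
  pose proof (pos_INR e) as He0. apply le_INR in He as He1. simpl in He1.
  (* This rounding makes [2 i - e] lie within 1 of [x]. *)
  destruct (nfloor_ex ((x + INR e + 1) / 2) ltac:(lra)) as [i [Hi1 Hi2]].
  assert (Hei : (e <= i)%nat).
  { assert (INR e < INR i + 1) as Hlt by lra. rewrite <- S_INR in Hlt. apply INR_lt in Hlt. lia. }
  pose proof (kernel_at_index e L i Hei He) as Hk.
  set (w := 2 * INR i - INR e) in *.
  assert (Hkw : Rabs (kernel e L w) <= 2).
  { rewrite Hk. destruct (Nat.leb i L); [rewrite Rabs_pos_eq; lra|rewrite Rabs_R0; lra]. }
  assert (Hd : Rabs (kernel e L x - kernel e L w) <= (PI / 2 - 0) * 3).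
  { rewrite kernel_diff. apply RInt_abs_le_const; [lra| |].
    - intros t. apply continuous_Rmult; [|apply continuous_dirichlet].
      apply (ex_derive_continuous (fun u => cos (x * u) - cos (w * u))). auto_derive. easy.
    - intros t Ht. rewrite Rabs_mult.
      pose proof (Rabs_cos_diff (x * t) (w * t)) as Hc.
      rewrite <- Rmult_minus_distr_r, Rabs_mult, (Rabs_pos_eq t) in Hc by lra.
      assert (Rabs (x - w) <= 1) by (apply Rabs_le; unfold w; lra).
      pose proof (dirichlet_bound e L t He Ht). pose proof (Rabs_pos (dirichlet e L t)).
      apply Rle_trans with (t * Rabs (dirichlet e L t)); [|assumption].
      apply Rmult_le_compat_r; nra. }
  replace (kernel e L x) with (kernel e L w + (kernel e L x - kernel e L w)) by ring.
  eapply Rle_trans; [apply Rabs_triang|]. lra.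
Qed.

Lemma is_derive_div_sin (F F' : R -> R) (t : R) :
  is_derive F t (F' t) -> sin t <> 0 ->
  is_derive (fun u => F u * / sin u) t ((F' t * sin t - F t * cos t) * / (sin t * sin t)).
Proof.
  intros HF Hs.
  assert (Hi : is_derive (fun u => / sin u) t (- cos t / (sin t) ^ 2)).
  { apply (is_derive_inv sin); [|exact Hs]. apply is_derive_Reals, derivable_pt_lim_sin. }
  pose proof (is_derive_mult F (fun u => / sin u) t _ _ HF Hi) as H.
  evar_last; [apply H; intros; apply Rmult_comm|].
  unfold plus, mult; simpl. field. exact Hs.
Qed.

(* Integration by parts against [sin (A t)], away from the pole of [1 / sin]. *)
Lemma RInt_div_sin_mul_sin_bound (F F' : R -> R) (d : R) :
  (forall t, is_derive F t (F' t)) -> (forall t, continuous F' t) ->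
  0 < d <= PI / 2 ->
  exists M, forall A, 0 < A ->
    Rabs (RInt (fun t => F t * / sin t * sin (A * t)) d (PI / 2)) <= M / A.
Proof.
  intros HF HF' Hd. pose proof PI_RGT_0.
  assert (Hs : forall t, d <= t <= PI / 2 -> sin t <> 0).
  { intros t Ht. apply Rgt_not_eq, sin_gt_0; lra. }
  set (g := fun t => F t * / sin t).
  set (g' := fun t => (F' t * sin t - F t * cos t) * / (sin t * sin t)).
  assert (Hg : forall t, d <= t <= PI / 2 -> is_derive g t (g' t)).
  { intros t Ht. apply is_derive_div_sin; [apply HF|now apply Hs]. }
  assert (HcF : forall t, continuous F t).
  { intros t. apply (ex_derive_continuous F). exists (F' t). apply HF. }
  assert (Hcsin : forall A t, continuous (fun u => sin (A * u)) t).
  { intros A t. apply (ex_derive_continuous (fun u => sin (A * u))). auto_derive. trivial. }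
  assert (Hcsin1 : forall t, continuous sin t).
  { intros t. apply (ex_derive_continuous sin). auto_derive. trivial. }
  assert (Hccos1 : forall t, continuous cos t).
  { intros t. apply (ex_derive_continuous cos). auto_derive. trivial. }
  assert (Hcg : forall t, d <= t <= PI / 2 -> continuous g t).
  { intros t Ht. apply (ex_derive_continuous g). exists (g' t). now apply Hg. }
  assert (Hcg' : forall t, d <= t <= PI / 2 -> continuous g' t).
  { intros t Ht. apply continuous_Rmult.
    - apply (continuous_minus (fun t => F' t * sin t) (fun t => F t * cos t));
        apply continuous_Rmult; auto.
    - apply continuous_Rinv_comp; [apply continuous_Rmult; auto|].
      apply Rmult_integral_contrapositive; split; now apply Hs. }
  assert (Hmm : Rmin d (PI / 2) = d /\ Rmax d (PI / 2) = PI / 2).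
  { split; [apply Rmin_left|apply Rmax_right]; lra. }
  destruct Hmm as [Hmin Hmax].
  exists (Rabs (g d) + Rabs (g (PI / 2)) + RInt (fun t => Rabs (g' t)) d (PI / 2)).
  intros A HA.
  set (U := fun t => - (g t * cos (A * t)) / A).
  set (V := fun t => g' t * cos (A * t)).
  assert (HcV : forall t, d <= t <= PI / 2 -> continuous V t).
  { intros t Ht. apply continuous_Rmult; [auto|apply continuous_cos_scal]. }
  assert (HexV : ex_RInt V d (PI / 2)).
  { apply (ex_RInt_continuous V). rewrite Hmin, Hmax. exact HcV. }
  assert (HU : is_RInt (fun t => g t * sin (A * t) + - / A * V t) d (PI / 2) (minus (U (PI / 2)) (U d))).
  { apply (is_RInt_derive U); rewrite Hmin, Hmax.
    - intros t Ht. unfold U, V.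
      assert (Hcos : is_derive (fun u => cos (A * u)) t (- A * sin (A * t))).
      { auto_derive; [trivial|ring]. }
      pose proof (is_derive_mult g (fun u => cos (A * u)) t _ _ (Hg t Ht) Hcos
        (fun n m => Rmult_comm n m)) as Hm.
      pose proof (is_derive_scal _ t (- / A) _ Hm) as Hk.
      eapply is_derive_ext; [|evar_last; [exact Hk|]].
      + intros u. simpl. unfold mult; simpl. field. lra.
      + unfold plus, mult; simpl. field. lra.
    - intros t Ht. apply continuous_Rplus; apply continuous_Rmult; auto.
      apply continuous_const. }
  assert (HVA : is_RInt (fun t => / A * V t) d (PI / 2) (/ A * RInt V d (PI / 2))).
  { apply (is_RInt_scal V), (RInt_correct V), HexV. }
  pose proof (is_RInt_plus _ _ _ _ _ _ HU HVA) as Hsum.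
  assert (Heq : RInt (fun t => F t * / sin t * sin (A * t)) d (PI / 2) =
    U (PI / 2) - U d + / A * RInt V d (PI / 2)).
  { apply is_RInt_unique. eapply is_RInt_ext; [|exact Hsum].
    intros t _. unfold plus; simpl. unfold g. ring. }
  rewrite Heq. unfold U.
  assert (HV : Rabs (RInt V d (PI / 2)) <= RInt (fun t => Rabs (g' t)) d (PI / 2)).
  { eapply Rle_trans; [apply abs_RInt_le; [lra|exact HexV]|].
    apply RInt_le; [lra| | |].
    - apply (ex_RInt_continuous (fun t => Rabs (V t))). rewrite Hmin, Hmax.
      intros t Ht. apply continuous_Rabs_comp. auto.
    - apply (ex_RInt_continuous (fun t => Rabs (g' t))). rewrite Hmin, Hmax.
      intros t Ht. apply continuous_Rabs_comp. auto.
    - intros t _. unfold V. rewrite Rabs_mult.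
      assert (Rabs (cos (A * t)) <= 1) by (apply Rabs_le, COS_bound).
      pose proof (Rabs_pos (g' t)). nra. }
  set (I := RInt V d (PI / 2)) in *. set (J := RInt (fun t => Rabs (g' t)) d (PI / 2)) in *.
  replace (- (g (PI / 2) * cos (A * (PI / 2))) / A - - (g d * cos (A * d)) / A + / A * I)
    with ((g d * cos (A * d) + (- (g (PI / 2) * cos (A * (PI / 2)))) + I) / A) by (field; lra).
  unfold Rdiv at 1. rewrite Rabs_mult, (Rabs_pos_eq (/ A)) by (left; now apply Rinv_0_lt_compat).
  apply Rmult_le_compat_r; [left; now apply Rinv_0_lt_compat|].
  assert (Hb : forall v w, Rabs (v * cos w) <= Rabs v).
  { intros v w. rewrite Rabs_mult.
    assert (Rabs (cos w) <= 1) by (apply Rabs_le, COS_bound). pose proof (Rabs_pos v). nra. }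
  pose proof (Hb (g d) (A * d)). pose proof (Hb (g (PI / 2)) (A * (PI / 2))).
  eapply Rle_trans; [apply Rabs_triang|].
  pose proof (Rabs_triang (g d * cos (A * d)) (- (g (PI / 2) * cos (A * (PI / 2))))) as Ht.
  rewrite Rabs_Ropp in Ht. lra.
Qed.

(** Near 0 the linear vanishing of [F] absorbs the bound [3 / t], uniformly in [L]; away from 0 the
    kernel is [sin (A t) / sin t] and integration by parts gains [1 / A]. *)
Lemma riemann_lebesgue_dirichlet (F F' : R -> R) (C : R) (e : nat) :
  (e <= 1)%nat -> (forall t, is_derive F t (F' t)) -> (forall t, continuous F' t) ->
  (forall t, 0 <= t <= PI / 2 -> Rabs (F t) <= C * t) ->
  is_lim_seq (fun L => RInt (fun t => F t * dirichlet e L t) 0 (PI / 2)) 0.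
Proof.
  intros He HF HF' HC. pose proof PI_RGT_0 as HPI.
  assert (HC0 : 0 <= C).
  { pose proof (HC (PI / 2) ltac:(lra)) as H. pose proof (Rabs_pos (F (PI / 2))). nra. }
  assert (HcF : forall t, continuous F t).
  { intros t. apply (ex_derive_continuous F). exists (F' t). apply HF. }
  assert (HcFD : forall L t, continuous (fun t => F t * dirichlet e L t) t).
  { intros L t. apply continuous_Rmult; [apply HcF|apply continuous_dirichlet]. }
  apply is_lim_seq_spec. intros [eps Heps]. simpl.
  (* The part on [[0, d]] is at most [3 C d], below [eps / 2]; the summand 6 keeps the denominator
     positive when [C = 0]. *)
  set (d := Rmin (PI / 2) (eps / (6 * C + 6))).
  assert (Hd0 : 0 < d).
  { apply Rmin_pos; [lra|]. apply Rdiv_lt_0_compat; lra. }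
  assert (Hd1 : d <= PI / 2) by apply Rmin_l.
  assert (Hd2 : d * (6 * C + 6) <= eps).
  { apply (Rle_div_r d); [lra|]. apply Rmin_r. }
  destruct (RInt_div_sin_mul_sin_bound F F' d HF HF' (conj Hd0 Hd1)) as [M HM].
  destruct (nfloor_ex (Rmax 0 (2 * M / eps)) (Rmax_l _ _)) as [N [_ HN]].
  exists (S N). intros L HL. rewrite Rminus_0_r.
  pose proof (RInt_Chasles (fun t => F t * dirichlet e L t) 0 d (PI / 2)
    (ex_RInt_cont _ _ _ (HcFD L)) (ex_RInt_cont _ _ _ (HcFD L))) as Hch.
  unfold plus in Hch; simpl in Hch. rewrite <- Hch.
  assert (H1 : Rabs (RInt (fun t => F t * dirichlet e L t) 0 d) <= (d - 0) * (3 * C)).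
  { apply RInt_abs_le_const; [lra|apply HcFD|].
    intros t Ht. rewrite Rabs_mult.
    pose proof (HC t ltac:(lra)). pose proof (dirichlet_bound e L t He ltac:(lra)).
    pose proof (Rabs_pos (dirichlet e L t)). nra. }
  apply le_INR in He as HeR. simpl in HeR.
  apply le_INR in HL as HLR. rewrite S_INR in HLR.
  pose proof (pos_INR N) as HN0.
  assert (HA : 0 < 2 * INR L + 1 - INR e) by lra.
  specialize (HM _ HA).
  assert (H2 : RInt (fun t => F t * dirichlet e L t) d (PI / 2) =
    RInt (fun t => F t * / sin t * sin ((2 * INR L + 1 - INR e) * t)) d (PI / 2)).
  { apply RInt_ext. intros t Ht.
    rewrite Rmin_left, Rmax_right in Ht by lra.
    rewrite <- dirichlet_sin by assumption. simpl.
    field. apply Rgt_not_eq, sin_gt_0; lra. }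
  rewrite H2.
  assert (H3 : M / (2 * INR L + 1 - INR e) < eps / 2).
  { apply (Rlt_div_l M); [lra|].
    assert (2 * M / eps < 2 * INR L + 1 - INR e).
    { pose proof (Rmax_r 0 (2 * M / eps)). lra. }
    apply (Rlt_div_l (2 * M)) in H; lra. }
  eapply Rle_lt_trans; [apply Rabs_triang|]. nra.
Qed.

(** The kernel at [z] is compared with the one at the frequency [e] of the class, which equals
    [PI / 2] as soon as [L >= e]; the difference of the two cosines vanishes at 0. *)
Lemma kernel_lim (e : nat) (z : R) :
  (e <= 1)%nat -> is_lim_seq (fun L => kernel e L z) (PI / 2).
Proof.
  intros He.
  assert (H : is_lim_seq (fun L => kernel e L z - kernel e L (INR e)) 0).
  { eapply is_lim_seq_ext; [intros L; symmetry; apply kernel_diff|].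
    apply (riemann_lebesgue_dirichlet (fun t => cos (z * t) - cos (INR e * t))
      (fun t => - z * sin (z * t) + INR e * sin (INR e * t)) (Rabs (z - INR e)) e He).
    - intros t. auto_derive; [easy|ring].
    - intros t.
      apply (ex_derive_continuous (fun t => - z * sin (z * t) + INR e * sin (INR e * t))).
      auto_derive. easy.
    - intros t Ht. eapply Rle_trans; [apply Rabs_cos_diff|].
      rewrite <- Rmult_minus_distr_r, Rabs_mult, (Rabs_pos_eq t) by lra. lra. }
  apply (is_lim_seq_incr_n _ e).
  apply (is_lim_seq_incr_n _ e) in H.
  replace (PI / 2) with (0 + PI / 2) by ring.
  eapply is_lim_seq_ext; [|apply (is_lim_seq_plus' _ _ _ _ H (is_lim_seq_const (PI / 2)))].
  intros L. simpl.
  pose proof (kernel_at_index e (L + e) e (le_n e) He) as Hk.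
  replace (2 * INR e - INR e) with (INR e) in Hk by ring.
  destruct (Nat.leb_spec e (L + e)); [|lia]. rewrite Hk. ring.
Qed.

(** * Rational values at integers *)

Definition rational (x : R) : Prop := exists q : Q, x = Q2R q.

Lemma rational_plus (x y : R) : rational x -> rational y -> rational (x + y).
Proof. intros [p ->] [q ->]. exists (p + q)%Q. now rewrite Q2R_plus. Qed.

Lemma rational_mult (x y : R) : rational x -> rational y -> rational (x * y).
Proof. intros [p ->] [q ->]. exists (p * q)%Q. now rewrite Q2R_mult. Qed.

Lemma rational_IZR (z : Z) : rational (IZR z).
Proof. exists (inject_Z z). unfold Q2R. simpl. field. Qed.

Lemma rational_INR (n : nat) : rational (INR n).
Proof. rewrite INR_IZR_INZ. apply rational_IZR. Qed.

Lemma rational_opp (x : R) : rational x -> rational (- x).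
Proof. intros [p ->]. exists (- p)%Q. now rewrite Q2R_opp. Qed.

Lemma rational_inv (x : R) : rational x -> rational (/ x).
Proof.
  intros [p ->]. destruct (Qeq_dec p 0) as [Hp|Hp].
  - exists 0%Q. rewrite (Qeq_eqR _ _ Hp). unfold Q2R; simpl.
    rewrite Rmult_0_l. apply Rinv_0.
  - exists (/ p)%Q. now rewrite Q2R_inv.
Qed.

Lemma rational_minus (x y : R) : rational x -> rational y -> rational (x - y).
Proof. intros Hx Hy. apply rational_plus; [exact Hx|now apply rational_opp]. Qed.

Lemma rational_div (x y : R) : rational x -> rational y -> rational (x / y).
Proof. intros Hx Hy. apply rational_mult; [exact Hx|now apply rational_inv]. Qed.

Lemma rational_pow (x : R) (n : nat) : rational x -> rational (x ^ n).
Proof.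
  intros Hx. induction n as [|n IH]; simpl; [apply (rational_IZR 1)|now apply rational_mult].
Qed.

Create HintDb rat.
#[local] Hint Resolve rational_plus rational_mult rational_IZR rational_INR rational_opp
  rational_inv rational_minus rational_div rational_pow : rat.

(** Stated for sequences of partial sums: linear relations between finite sums then pass to the
    limit, and conditionally convergent series need no separate treatment. *)
Definition pi_rational_lim (d : nat) (u : nat -> R) : Prop :=
  exists x, rational x /\ is_lim_seq u (PI ^ d * x).

Lemma pi_rational_lim_ext (d : nat) (u v : nat -> R) :
  (forall n, u n = v n) -> pi_rational_lim d u -> pi_rational_lim d v.
Proof. intros H [x [Hx Hu]]. exists x. split; [exact Hx|]. now apply (is_lim_seq_ext u). Qed.

Lemma pi_rational_lim_const (d : nat) (x : R) :
  rational x -> pi_rational_lim d (fun _ => PI ^ d * x).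
Proof. intros Hx. exists x. split; [exact Hx|]. apply is_lim_seq_const. Qed.

Lemma pi_rational_lim_zero (d : nat) (u : nat -> R) :
  (forall n, u n = 0) -> pi_rational_lim d u.
Proof.
  intros H. apply (pi_rational_lim_ext d (fun _ => PI ^ d * 0)).
  - intros n. rewrite H. ring.
  - apply pi_rational_lim_const, (rational_IZR 0).
Qed.

Lemma pi_rational_lim_plus (d : nat) (u v : nat -> R) :
  pi_rational_lim d u -> pi_rational_lim d v -> pi_rational_lim d (fun n => u n + v n).
Proof.
  intros [x [Hx Hu]] [y [Hy Hv]]. exists (x + y). split; [auto with rat|].
  rewrite Rmult_plus_distr_l. now apply is_lim_seq_plus'.
Qed.

Lemma pi_rational_lim_scal (d k : nat) (c : R) (u : nat -> R) :
  rational c -> pi_rational_lim d u -> pi_rational_lim (d + k) (fun n => c * PI ^ k * u n).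
Proof.
  intros Hc [x [Hx Hu]]. exists (c * x). split; [auto with rat|].
  replace (PI ^ (d + k) * (c * x)) with (c * PI ^ k * (PI ^ d * x)) by (rewrite pow_add; ring).
  now apply (is_lim_seq_scal_l u (c * PI ^ k) (PI ^ d * x)).
Qed.

(** Allows a linear relation between sums to be solved for one of them. *)
Lemma pi_rational_lim_cancel (d k : nat) (c : R) (u : nat -> R) :
  rational c -> c <> 0 ->
  pi_rational_lim (d + k) (fun n => c * PI ^ k * u n) -> pi_rational_lim d u.
Proof.
  intros Hc Hc0 [x [Hx Hu]]. exists (x / c). split; [auto with rat|].
  assert (HP : PI ^ k <> 0) by apply pow_nonzero, PI_neq0.
  apply (is_lim_seq_scal_l _ (/ (c * PI ^ k)) (PI ^ (d + k) * x)) in Hu.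
  simpl in Hu.
  replace (PI ^ d * (x / c)) with (/ (c * PI ^ k) * (PI ^ (d + k) * x)).
  2: { rewrite pow_add. field. now split. }
  eapply is_lim_seq_ext; [|exact Hu].
  intros n. simpl. field. now split.
Qed.

(** For [p] in one class modulo 2 these are Fourier coefficients of [t ^ j]; their sum evaluates
    [t ^ j] at 0, up to the constant term. *)
Definition cos_moment (j : nat) (p : R) : R := RInt (fun t => t ^ j * cos (p * t)) 0 (PI / 2).

Lemma continuous_pow (j : nat) (t : R) : continuous (fun t => t ^ j) t.
Proof. apply (ex_derive_continuous (fun t => t ^ j)). auto_derive. trivial. Qed.

Lemma RInt_pow (n : nat) (a : R) : RInt (fun t => t ^ n) 0 a = a ^ S n / INR (S n) :> R.
Proof.
  apply is_RInt_unique.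
  replace (a ^ S n / INR (S n)) with (a ^ S n / INR (S n) - 0 ^ S n / INR (S n)).
  2: { rewrite (pow_i (S n)) by lia. unfold Rdiv. ring. }
  apply (is_RInt_derive (fun t => t ^ S n / INR (S n))).
  - intros t _. assert (INR (S n) <> 0) by (apply not_0_INR; lia).
    auto_derive; [trivial|]. change (match n with O => 1 | S _ => INR n + 1 end) with (INR (S n)).
    field. assumption.
  - intros t _. apply continuous_pow.
Qed.

Lemma cos_moment_0 (p : R) : p <> 0 -> cos_moment 0 p = sin (p * (PI / 2)) * / p.
Proof.
  intros Hp. change (sin (p * (PI / 2)) * / p) with (sin (p * (PI / 2)) / p).
  rewrite <- (RInt_cos p Hp).
  apply RInt_Rext. intros t. simpl. ring.
Qed.

(** Two integrations by parts; the boundary terms at 0 carry positive powers of [t] and vanish. *)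
Lemma cos_moment_SS (j : nat) (p : R) :
  p <> 0 ->
  cos_moment (S (S j)) p =
    (PI / 2) ^ S (S j) * (sin (p * (PI / 2)) * / p)
    + INR (S (S j)) * (PI / 2) ^ S j * (cos (p * (PI / 2)) * (/ p * / p))
    - INR (S (S j)) * INR (S j) * (cos_moment j p * (/ p * / p)).
Proof.
  intros Hp. unfold cos_moment.
  set (U := fun t => t ^ S (S j) * sin (p * t) * / p
                     + INR (S (S j)) * t ^ S j * cos (p * t) * (/ p * / p)).
  assert (HcV : forall i t, continuous (fun t => t ^ i * cos (p * t)) t).
  { intros i t. apply continuous_Rmult; [apply continuous_pow|apply continuous_cos_scal]. }
  assert (Hc : forall t, continuous (fun t =>
    INR (S (S j)) * INR (S j) * (/ p * / p) * (t ^ j * cos (p * t))) t).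
  { intros t. apply continuous_Rmult; [apply continuous_const|apply HcV]. }
  assert (HU : RInt (fun t => t ^ S (S j) * cos (p * t) +
     INR (S (S j)) * INR (S j) * (/ p * / p) * (t ^ j * cos (p * t))) 0 (PI / 2) =
     U (PI / 2) - U 0).
  { apply is_RInt_unique. apply (is_RInt_derive U).
    - intros t _. unfold U. auto_derive; [trivial|].
      change (match j with O => 1 | S _ => INR j + 1 end) with (INR (S j)).
      rewrite !S_INR. simpl. field. exact Hp.
    - intros t _. apply continuous_Rplus; [apply HcV|apply Hc]. }
  rewrite RInt_Rplus, RInt_Rscal in HU by (apply HcV || apply Hc).
  assert (HU0 : U 0 = 0) by (unfold U; simpl; ring).
  rewrite HU0 in HU. unfold U in HU. lra.
Qed.

Section RationalSums.

Context (e : nat) (He : (e <= 1)%nat).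

Let p (l : nat) : R := 2 * INR l - INR e.

Let sinsum (b L : nat) : R := psum (fun l => sin (p l * (PI / 2)) * (/ p l) ^ b) L.
Let cossum (a L : nat) : R := psum (fun l => cos (p l * (PI / 2)) * (/ p l) ^ a) L.
Let moments (j i L : nat) : R := psum (fun l => cos_moment (2 * j) (p l) * (/ p l) ^ (2 * i)) L.

Let p_neq0 (l : nat) : (1 <= l)%nat -> p l <> 0.
Proof. intros Hl. apply le_INR in Hl, He. simpl in Hl, He. unfold p. lra. Qed.

Let moments_0 (i L : nat) : moments 0 i L = sinsum (2 * i + 1) L.
Proof.
  apply psum_ext. intros l Hl. rewrite Nat.mul_0_r, cos_moment_0 by (apply p_neq0; lia).
  rewrite pow_add, pow_1. ring.
Qed.

(** The recursion that drives the section: a moment of order [2j + 2] is traded for one of order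
    [2j] with two more factors [1 / p], at the cost of the very sums to be determined. *)
Let moments_S (i j L : nat) :
  moments (S j) i L =
    (/ 2) ^ (2 * j + 2) * PI ^ (2 * j + 2) * sinsum (2 * i + 1) L
    + INR (2 * j + 2) * (/ 2) ^ (2 * j + 1) * PI ^ (2 * j + 1) * cossum (2 * i + 2) L
    - INR (2 * j + 2) * INR (2 * j + 1) * moments j (S i) L.
Proof.
  unfold moments, sinsum, cossum.
  unfold Rminus. rewrite <- Ropp_mult_distr_l_reverse.
  rewrite <- !psum_scal, <- !psum_plus. apply psum_ext. intros l Hl.
  replace (2 * S j)%nat with (S (S (2 * j))) by lia.
  rewrite cos_moment_SS by (apply p_neq0; lia).
  replace (2 * j + 2)%nat with (S (S (2 * j))) by lia.
  replace (2 * j + 1)%nat with (S (2 * j)) by lia.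
  replace (2 * i + 2)%nat with (2 + 2 * i)%nat by lia.
  replace (2 * S i)%nat with (2 + 2 * i)%nat by lia.
  rewrite (Nat.add_comm (2 * i) 1), !pow_add.
  replace (PI / 2) with (/ 2 * PI) by field.
  rewrite !Rpow_mult_distr. simpl (_ ^ 2). simpl (_ ^ 1). ring.
Qed.

(** Fourier inversion at [t = 0]: against the Dirichlet kernels, [t ^ (2j)] tends to [PI / 2] for
    [j = 0] and to 0 otherwise. The frequency 0, absent from [moments], is subtracted, and the
    pairing of [p] with [- p] accounts for the factor 2. *)
Let moments_lim_base (j : nat) : pi_rational_lim (2 * j + 1) (moments j 0).
Proof.
  assert (HJ : pi_rational_lim (2 * j + 1)
    (fun L => RInt (fun t => t ^ (2 * j) * dirichlet e L t) 0 (PI / 2))).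
  { destruct j as [|i].
    - exists (/ 2). split; [auto with rat|].
      replace (PI ^ (2 * 0 + 1) * / 2) with (PI / 2) by (simpl; field).
      eapply is_lim_seq_ext; [|apply (kernel_lim e 0 He)].
      intros L. unfold kernel. apply RInt_Rext. intros t.
      rewrite Rmult_0_l, cos_0. simpl. ring.
    - exists 0. split; [apply rational_IZR|]. rewrite Rmult_0_r.
      replace (2 * S i)%nat with (S (S (2 * i))) by lia.
      apply (riemann_lebesgue_dirichlet (fun t => t ^ S (S (2 * i)))
        (fun t => INR (S (S (2 * i))) * t ^ S (2 * i)) ((PI / 2) ^ S (2 * i)) e He).
      + intros t. auto_derive; [trivial|]. apply Rmult_1_l.
      + intros t. apply continuous_Rmult; [apply continuous_const|apply continuous_pow].
      + intros t Ht. rewrite Rabs_pos_eq by (apply pow_le; lra).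
        change (t ^ S (S (2 * i))) with (t * t ^ S (2 * i)).
        rewrite Rmult_comm. apply Rmult_le_compat_r; [lra|]. apply pow_incr. lra. }
  assert (Hpow : RInt (fun t => t ^ (2 * j)) 0 (PI / 2) =
    PI ^ (2 * j + 1) * ((/ 2) ^ (2 * j + 1) * / INR (2 * j + 1)) :> R).
  { rewrite RInt_pow, Nat.add_1_r. unfold Rdiv. rewrite Rpow_mult_distr. ring. }
  apply (pi_rational_lim_cancel (2 * j + 1) 0 2); [apply rational_IZR|lra|].
  rewrite Nat.add_0_r.
  eapply pi_rational_lim_ext; [|apply (pi_rational_lim_plus _ _ _ HJ
    (pi_rational_lim_const (2 * j + 1)
       (- (1 - INR e) * ((/ 2) ^ (2 * j + 1) * / INR (2 * j + 1))) ltac:(auto 8 with rat)))].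
  intros L. cbv beta. change (PI ^ 0) with 1. rewrite RInt_dirichlet by apply continuous_pow.
  rewrite Hpow, psum_scal. unfold moments.
  rewrite (psum_ext (fun l => cos_moment (2 * j) (p l) * (/ p l) ^ (2 * 0))
    (fun l => cos_moment (2 * j) (p l))).
  - unfold cos_moment, p. ring.
  - intros l _. simpl. ring.
Qed.

Let sinsum_even_class (b L : nat) : e = 0%nat -> sinsum b L = 0.
Proof.
  intros He0. apply psum_zero. intros l _. unfold p. rewrite He0. simpl.
  replace ((2 * INR l - 0) * (PI / 2)) with (INR l * PI) by field.
  rewrite sin_INR_PI. ring.
Qed.

Let cossum_odd_class (a L : nat) : e = 1%nat -> cossum a L = 0.
Proof.
  intros He0. apply psum_zero. intros l _. unfold p. rewrite He0. simpl.
  replace ((2 * INR l - 1) * (PI / 2)) with (INR l * PI - PI / 2) by field.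
  rewrite cos_minus, cos_PI2, sin_INR_PI. ring.
Qed.

(** For even [p] all the sines vanish, and the recursion for [moments 1 i] leaves only [PI] times
    the cosine sum; for odd [p] the cosines vanish. *)
Let cossum_lim (i : nat) :
  pi_rational_lim (2 * 1 + 2 * i + 1) (moments 1 i) ->
  pi_rational_lim (2 * i + 2) (cossum (2 * i + 2)).
Proof.
  intros H. assert (e = 0 \/ e = 1)%nat as [He0|He0] by lia.
  - apply (pi_rational_lim_cancel (2 * i + 2) 1 1); [apply rational_IZR|lra|].
    replace (2 * i + 2 + 1)%nat with (2 * 1 + 2 * i + 1)%nat by lia.
    eapply pi_rational_lim_ext; [|exact H]. intros L. simpl.
    rewrite moments_S, moments_0, !sinsum_even_class by exact He0.
    simpl. field.
  - apply pi_rational_lim_zero. intros L. now apply cossum_odd_class.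
Qed.

(** Induction on [i] for all [j] at once, because [moments j (S i)] is obtained from
    [moments (S j) i]; the cases [j = 0] and [j = 1] supply the sine and cosine sums of the
    recursion. *)
Let moments_lim (i : nat) : forall j, pi_rational_lim (2 * j + 2 * i + 1) (moments j i).
Proof.
  induction i as [|i IH]; intros j.
  - rewrite Nat.mul_0_r, Nat.add_0_r. apply moments_lim_base.
  - assert (HS : pi_rational_lim (2 * i + 1) (sinsum (2 * i + 1))).
    { eapply pi_rational_lim_ext; [apply moments_0|apply (IH 0%nat)]. }
    pose proof (cossum_lim i (IH 1%nat)) as HC.
    set (c := INR (2 * j + 2) * INR (2 * j + 1)).
    assert (Hc : c <> 0).
    { apply Rmult_integral_contrapositive; split; apply not_0_INR; lia. }
    assert (Hcr : rational c) by (unfold c; auto with rat).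
    apply (pi_rational_lim_cancel _ 0 c _ Hcr Hc). rewrite Nat.add_0_r.
    apply (pi_rational_lim_scal _ (2 * j + 2) ((/ 2) ^ (2 * j + 2))) in HS; [|auto with rat].
    apply (pi_rational_lim_scal _ (2 * j + 1) (INR (2 * j + 2) * (/ 2) ^ (2 * j + 1))) in HC;
      [|auto with rat].
    pose proof (pi_rational_lim_scal _ 0 (-1) _ (rational_IZR _) (IH (S j))) as HM.
    replace (2 * j + 2 * S i + 1)%nat with (2 * i + 1 + (2 * j + 2))%nat by lia.
    replace (2 * i + 2 + (2 * j + 1))%nat with (2 * i + 1 + (2 * j + 2))%nat in HC by lia.
    replace (2 * S j + 2 * i + 1 + 0)%nat with (2 * i + 1 + (2 * j + 2))%nat in HM by lia.
    eapply pi_rational_lim_ext;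
      [|exact (pi_rational_lim_plus _ _ _ HM (pi_rational_lim_plus _ _ _ HS HC))].
    intros L. simpl (PI ^ 0). cbv beta. rewrite moments_S. unfold c. ring.
Qed.

Lemma class_sin_sum_lim (i : nat) :
  pi_rational_lim (2 * i + 1)
    (psum (fun l => sin ((2 * INR l - INR e) * (PI / 2)) * (/ (2 * INR l - INR e)) ^ (2 * i + 1))).
Proof. eapply pi_rational_lim_ext; [apply moments_0|apply (moments_lim i 0)]. Qed.

Lemma class_cos_sum_lim (i : nat) :
  pi_rational_lim (2 * i + 2)
    (psum (fun l => cos ((2 * INR l - INR e) * (PI / 2)) * (/ (2 * INR l - INR e)) ^ (2 * i + 2))).
Proof. apply cossum_lim, moments_lim. Qed.

End RationalSums.

Lemma INR_pred_double (l : nat) : (1 <= l)%nat -> INR (2 * l - 1) = 2 * INR l - INR 1.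
Proof. intros Hl. rewrite minus_INR, mult_INR by lia. simpl. ring. Qed.

Lemma sin_sum_lim (b : nat) :
  Nat.odd b = true ->
  pi_rational_lim b (fun L => psum (fun n => sin (INR n * (PI / 2)) * (/ INR n) ^ b) (2 * L)).
Proof.
  intros Hb. apply Nat.odd_spec in Hb. destruct Hb as [i ->].
  eapply pi_rational_lim_ext; [|apply (class_sin_sum_lim 1 (le_n 1))].
  intros L. cbv beta. rewrite psum_pairs.
  rewrite (psum_zero (fun l => sin (INR (2 * l) * (PI / 2)) * _)).
  - rewrite Rplus_0_r. apply psum_ext. intros l Hl. now rewrite INR_pred_double by lia.
  - intros l _. rewrite mult_INR. simpl (INR 2).
    replace ((1 + 1) * INR l * (PI / 2)) with (INR l * PI) by field.
    rewrite sin_INR_PI. ring.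
Qed.

Lemma cos_sum_lim (a : nat) :
  Nat.even a = true -> (1 <= a)%nat ->
  pi_rational_lim a (fun L => psum (fun n => cos (INR n * (PI / 2)) * (/ INR n) ^ a) (2 * L)).
Proof.
  intros Ha Ha1. apply Nat.even_spec in Ha. destruct Ha as [[|i] ->]; [lia|].
  replace (2 * S i)%nat with (2 * i + 2)%nat by lia.
  eapply pi_rational_lim_ext; [|apply (class_cos_sum_lim 0 (Nat.le_0_l 1))].
  intros L. cbv beta. rewrite psum_pairs.
  rewrite (psum_zero (fun l => cos (INR (2 * l - 1) * (PI / 2)) * _)).
  - rewrite Rplus_0_l. apply psum_ext. intros l Hl. rewrite mult_INR. simpl (INR 2). simpl (INR 0).
    now replace (2 * INR l - 0) with ((1 + 1) * INR l) by ring.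
  - intros l Hl. rewrite INR_pred_double by lia. simpl (INR 1).
    replace ((2 * INR l - 1) * (PI / 2)) with (INR l * PI - PI / 2) by field.
    rewrite cos_minus, cos_PI2, sin_INR_PI. ring.
Qed.

(** * The functional equation *)

(** The terms of index [p] and [- p] of [sum_p chi (p - n) / (p - n y)], where
    [chi d = sin (PI d / 2)] is the odd character modulo 4. *)
Definition chi_term (n p y : R) : R :=
  sin ((p - n) * (PI / 2)) / (p - n * y) + sin ((p + n) * (PI / 2)) / (p + n * y).

Definition chi_sum (n y : R) (L : nat) : R := psum (fun p => chi_term n (INR p) y) (2 * L).

Definition sin_sum (b L : nat) : R :=
  psum (fun n => sin (INR n * (PI / 2)) * (/ INR n) ^ b) (2 * L).
Definition cos_sum (a L : nat) : R :=
  psum (fun n => cos (INR n * (PI / 2)) * (/ INR n) ^ a) (2 * L).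

Lemma geometric_diff (a b : R) (M : nat) :
  a ^ M - b ^ M = (a - b) * psum (fun i => a ^ (i - 1) * b ^ (M - i)) M.
Proof.
  induction M as [|M IH]; [simpl; ring|]. cbn [psum].
  rewrite (psum_ext _ (fun i => b * (a ^ (i - 1) * b ^ (M - i)))), psum_scal.
  - rewrite Nat.sub_diag. replace (S M - 1)%nat with M by lia.
    replace (a ^ S M - b ^ S M) with ((a - b) * a ^ M + b * (a ^ M - b ^ M)) by (simpl; ring).
    rewrite IH. simpl. ring.
  - intros i Hi. replace (S M - i)%nat with (S (M - i)) by lia. simpl. ring.
Qed.

(** Combining [p] with [- p] leaves a single product of a sine and a cosine. For even [M] the sines
    carry odd exponents and the cosines even ones, exactly the sums evaluated above. *)
Definition box_coef (M i : nat) (n p : R) : R :=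
  if Nat.odd i
  then -2 * ((sin (p * (PI / 2)) * (/ p) ^ i) * (cos (n * (PI / 2)) * (/ n) ^ (M + 1 - i)))
  else 2 * ((cos (p * (PI / 2)) * (/ p) ^ i) * (sin (n * (PI / 2)) * (/ n) ^ (M + 1 - i))).

(** With [y / p - 1 / n = - (p - n y) / (n p)] the geometric factorisation cancels [p - n y];
    replacing [y / p] by [- y / p] cancels [p + n y]. Both cancellations share one prefactor because
    the exponent [2 m] is even. *)
Lemma chi_term_expand (m : nat) (n p y : R) :
  n <> 0 -> p <> 0 -> p - n * y <> 0 -> p + n * y <> 0 ->
  ((y * / p) ^ (2 * m) - (/ n) ^ (2 * m)) * chi_term n p y =
  psum (fun i => y ^ (i - 1) * box_coef (2 * m) i n p) (2 * m).
Proof.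
  intros Hn Hp Hm Hpl. set (M := (2 * m)%nat).
  set (a := y * / p). set (b := / n).
  pose proof (geometric_diff a b M) as H1.
  pose proof (geometric_diff (- a) b M) as H2.
  assert (Ha : (- a) ^ M = a ^ M).
  { unfold M. rewrite !pow_mult. f_equal. ring. }
  rewrite Ha in H2. unfold chi_term.
  set (s1 := psum (fun i => a ^ (i - 1) * b ^ (M - i)) M) in *.
  set (s2 := psum (fun i => (- a) ^ (i - 1) * b ^ (M - i)) M) in *.
  set (c1 := sin ((p - n) * (PI / 2))). set (c2 := sin ((p + n) * (PI / 2))).
  replace ((a ^ M - b ^ M) * (c1 / (p - n * y) + c2 / (p + n * y)))
    with ((a ^ M - b ^ M) * (c1 / (p - n * y)) + (a ^ M - b ^ M) * (c2 / (p + n * y))) by ring.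
  rewrite H1 at 1. rewrite H2.
  replace ((a - b) * s1 * (c1 / (p - n * y)) + (- a - b) * s2 * (c2 / (p + n * y)))
    with ((- (/ p * / n) * c1) * s1 + (- (/ p * / n) * c2) * s2).
  2: { unfold a, b. field. repeat split; assumption. }
  unfold s1, s2. rewrite <- !psum_scal, <- psum_plus. apply psum_ext. intros i Hi.
  replace ((- a) ^ (i - 1)) with ((-1) ^ (i - 1) * a ^ (i - 1)).
  2: { rewrite <- Rpow_mult_distr. f_equal. ring. }
  unfold a, c1, c2, box_coef. rewrite Rpow_mult_distr.
  rewrite Rmult_minus_distr_r, Rmult_plus_distr_r, sin_minus, sin_plus.
  replace ((/ p) ^ i) with (/ p * (/ p) ^ (i - 1)).
  2: { replace i with (S (i - 1)) at 2 by lia. reflexivity. }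
  replace ((/ n) ^ (M + 1 - i)) with (/ n * b ^ (M - i)).
  2: { replace (M + 1 - i)%nat with (S (M - i)) by lia. reflexivity. }
  destruct (Nat.odd i) eqn:Ho.
  - apply Nat.odd_spec in Ho. destruct Ho as [j ->].
    replace (2 * j + 1 - 1)%nat with (2 * j)%nat by lia. rewrite pow_1_even. ring.
  - assert (He : Nat.even i = true) by (rewrite <- Nat.negb_odd, Ho; reflexivity).
    apply Nat.even_spec in He. destruct He as [[|j] ->]; [lia|].
    replace (2 * S j - 1)%nat with (S (2 * j)) by lia. rewrite pow_1_odd. ring.
Qed.

Lemma chi_term_swap (n p y : R) :
  y <> 0 -> p - n * y <> 0 -> p + n * y <> 0 -> chi_term n p y = / y * chi_term p n (/ y).
Proof.
  intros Hy H1 H2. unfold chi_term.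
  replace ((n - p) * (PI / 2)) with (- ((p - n) * (PI / 2))) by ring.
  rewrite sin_neg, (Rplus_comm n p).
  assert (n - p * / y <> 0).
  { intros H. apply H1. replace (p - n * y) with (- (y * (n - p * / y))) by (field; exact Hy).
    rewrite H. ring. }
  assert (n + p * / y <> 0).
  { intros H'. apply H2. replace (p + n * y) with (y * (n + p * / y)) by (field; exact Hy).
    rewrite H'. ring. }
  field. repeat split; try assumption;
    [replace (n * y + p) with (p + n * y) by ring|replace (n * y - p) with (- (p - n * y)) by ring;
     apply Ropp_neq_0_compat]; assumption.
Qed.

Definition weighted_chi_sum (M : nat) (y : R) (L : nat) : R :=
  psum (fun n => (/ INR n) ^ M * chi_sum (INR n) y L) (2 * L).

Definition irrational (y : R) : Prop := forall u v : Z, v <> 0%Z -> IZR v * y <> IZR u.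

Lemma irrational_neq0 (y : R) : irrational y -> y <> 0.
Proof. intros H H0. apply (H 0%Z 1%Z); [lia|]. rewrite H0. ring. Qed.

Lemma irrational_minus_neq0 (y : R) (n p : nat) :
  irrational y -> (1 <= n)%nat -> INR p - INR n * y <> 0.
Proof.
  intros H Hn H0. apply (H (Z.of_nat p) (Z.of_nat n)); [lia|].
  rewrite <- !INR_IZR_INZ. lra.
Qed.

Lemma irrational_plus_neq0 (y : R) (n p : nat) :
  irrational y -> (1 <= n)%nat -> INR p + INR n * y <> 0.
Proof.
  intros H Hn H0. apply (H (- Z.of_nat p)%Z (Z.of_nat n)); [lia|].
  rewrite opp_IZR, <- !INR_IZR_INZ. lra.
Qed.

(** Sum the expansion over the square box. The part with [1 / n^(2m)] is a weighted sum as it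
    stands; the part with [y^(2m) / p^(2m)] becomes one at [1 / y] after [chi_term_swap] and a
    change of the order of summation. *)
Lemma weighted_chi_sum_reciprocity (m : nat) (y : R) (L : nat) :
  irrational y ->
  y ^ (2 * m) * / y * weighted_chi_sum (2 * m) (/ y) L - weighted_chi_sum (2 * m) y L =
  psum (fun i => y ^ (i - 1) *
    (if Nat.odd i then -2 * (sin_sum i L * cos_sum (2 * m + 1 - i) L)
     else 2 * (cos_sum i L * sin_sum (2 * m + 1 - i) L))) (2 * m).
Proof.
  intros Hy. set (M := (2 * m)%nat). pose proof (irrational_neq0 y Hy) as Hy0.
  assert (Hbox : psum (fun n => psum (fun p =>
      ((y * / INR p) ^ M - (/ INR n) ^ M) * chi_term (INR n) (INR p) y) (2 * L)) (2 * L) =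
    psum (fun n => psum (fun p => psum (fun i => y ^ (i - 1) * box_coef M i (INR n) (INR p)) M)
      (2 * L)) (2 * L)).
  { apply psum_ext. intros n Hn. apply psum_ext. intros p Hp. apply chi_term_expand;
      [apply not_0_INR; lia|apply not_0_INR; lia| |];
      [apply irrational_minus_neq0|apply irrational_plus_neq0]; trivial; lia. }
  transitivity (psum (fun n => psum (fun p =>
      ((y * / INR p) ^ M - (/ INR n) ^ M) * chi_term (INR n) (INR p) y) (2 * L)) (2 * L)).
  - rewrite (psum_ext _ (fun n =>
      psum (fun p => (y * / INR p) ^ M * chi_term (INR n) (INR p) y) (2 * L) +
      (-1) * ((/ INR n) ^ M * chi_sum (INR n) y L))).
    2: { intros n _. unfold chi_sum. rewrite <- !psum_scal, <- psum_plus.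
         apply psum_ext. intros p _. ring. }
    rewrite psum_plus, psum_scal, psum_swap.
    fold (weighted_chi_sum M y L).
    rewrite (psum_ext (fun p => psum _ (2 * L))
      (fun p => y ^ M * / y * ((/ INR p) ^ M * chi_sum (INR p) (/ y) L))).
    + rewrite psum_scal. unfold weighted_chi_sum. ring.
    + intros p Hp. unfold chi_sum. rewrite <- !psum_scal. apply psum_ext. intros n Hn.
      rewrite (chi_term_swap (INR n) (INR p) y), Rpow_mult_distr; [ring|exact Hy0| |];
      [apply irrational_minus_neq0|apply irrational_plus_neq0]; trivial; lia.
  - rewrite Hbox.
    rewrite (psum_ext _ (fun n => psum (fun i => psum (fun p =>
      y ^ (i - 1) * box_coef M i (INR n) (INR p)) (2 * L)) M)).
    2: { intros n _. apply (psum_swap (fun p i => y ^ (i - 1) * box_coef M i (INR n) (INR p))). }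
    rewrite psum_swap. apply psum_ext. intros i _.
    unfold box_coef, sin_sum, cos_sum. destruct (Nat.odd i).
    + rewrite psum_swap, <- psum_mult, <- !psum_scal. apply psum_ext. intros p _.
      rewrite <- !psum_scal. apply psum_ext. intros n _. ring.
    + rewrite psum_swap, <- psum_mult, <- !psum_scal. apply psum_ext. intros p _.
      rewrite <- !psum_scal. apply psum_ext. intros n _. ring.
Qed.

Lemma cos_neq0_irrational (y : R) (n : nat) :
  irrational y -> (1 <= n)%nat -> cos (PI * INR n * ((y - 1) / 2)) <> 0.
Proof.
  intros Hy Hn H. apply cos_eq_0_0 in H. destruct H as [k Hk].
  apply (Hy (2 * k + 1 + Z.of_nat n)%Z (Z.of_nat n)); [lia|].
  rewrite !plus_IZR, mult_IZR, <- INR_IZR_INZ.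
  apply (Rmult_eq_reg_l (PI / 2)); [|pose proof PI_RGT_0; lra].
  replace (PI / 2 * (INR n * y)) with (PI * INR n * ((y - 1) / 2) + PI / 2 * INR n) by field.
  rewrite Hk. field.
Qed.

(** [e] is the parity opposite to that of [n], hence the class of those [p] for which [chi (p - n)]
    does not vanish. *)
Lemma parity_class (n : nat) :
  exists k e : nat, (e <= 1)%nat /\ INR n = 2 * INR k - (1 - INR e).
Proof.
  destruct (Nat.Even_or_Odd n) as [[k ->]|[k ->]].
  - exists k, 1%nat. split; [lia|]. rewrite mult_INR. simpl. ring.
  - exists (S k), 0%nat. split; [lia|]. rewrite plus_INR, mult_INR, (S_INR k).
    simpl (INR 2). simpl (INR 1). simpl (INR 0). ring.
Qed.

Lemma sin_PI_comb (k l e : nat) :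
  sin ((INR l - INR k - INR e) * PI) = 0 /\ sin ((INR l + INR k - INR e) * PI) = 0.
Proof.
  split; [rewrite !Rmult_minus_distr_r|rewrite Rmult_minus_distr_r, Rmult_plus_distr_r];
  rewrite !sin_minus, ?sin_plus, ?cos_minus, ?cos_plus, !sin_INR_PI; ring.
Qed.

(** When [p - n] is odd, [cos ((p - n) PI / 2) = 0], so the addition formula turns
    [sin ((p - n y) PI / 2)] into [chi (p - n)] times a cosine that does not depend on [p]. The
    extra fraction next to [chi_sum] is the term [p = 0]. *)
Lemma chi_sum_kernel (n : nat) (y : R) :
  irrational y -> (1 <= n)%nat ->
  exists e, (e <= 1)%nat /\ forall L,
    cos (PI * INR n * ((y - 1) / 2)) *
      (sin (INR n * (PI / 2)) * / (INR n * y) + chi_sum (INR n) y L) = kernel e L (INR n * y).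
Proof.
  intros Hy Hn. destruct (parity_class n) as [k [e [He Hnk]]].
  exists e. split; [exact He|]. intros L.
  set (w := (INR n - INR n * y) * (PI / 2)).
  replace (PI * INR n * ((y - 1) / 2)) with (- w) by (unfold w; field).
  rewrite cos_neg.
  assert (Hz : INR n * y <> 0).
  { apply Rmult_integral_contrapositive; split; [apply not_0_INR; lia|now apply irrational_neq0]. }
  assert (He01 : e = 0%nat \/ e = 1%nat) by lia.
  rewrite kernel_eq, Rmult_plus_distr_l. f_equal.
  - rewrite RInt_cos by exact Hz.
    replace (INR n * y * (PI / 2)) with (INR n * (PI / 2) - w) by (unfold w; ring).
    rewrite sin_minus.
    destruct He01 as [-> | ->].
    + assert (cos (INR n * (PI / 2)) = 0) as ->.
      { rewrite Hnk. simpl (INR 0).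
        replace ((2 * INR k - (1 - 0)) * (PI / 2)) with (INR k * PI - PI / 2) by field.
        rewrite cos_minus, cos_PI2, sin_INR_PI. ring. }
      simpl (INR 0). field. split; [now apply irrational_neq0|apply not_0_INR; lia].
    + assert (sin (INR n * (PI / 2)) = 0) as ->.
      { rewrite Hnk. simpl (INR 1).
        replace ((2 * INR k - (1 - 1)) * (PI / 2)) with (INR k * PI) by field.
        apply sin_INR_PI. }
      simpl (INR 1). ring.
  - unfold chi_sum. rewrite psum_pairs.
    assert (Hwrong : forall l, chi_term (INR n) (2 * INR l - (1 - INR e)) y = 0).
    { intros l. unfold chi_term. rewrite Hnk.
      replace ((2 * INR l - (1 - INR e) - (2 * INR k - (1 - INR e))) * (PI / 2))
        with ((INR l - INR k - INR 0) * PI) by (simpl; field).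
      replace ((2 * INR l - (1 - INR e) + (2 * INR k - (1 - INR e))) * (PI / 2))
        with ((INR l + INR k - INR (1 - e)) * PI) by (rewrite minus_INR by lia; simpl; field).
      destruct (sin_PI_comb k l 0) as [-> _]. destruct (sin_PI_comb k l (1 - e)) as [_ ->].
      unfold Rdiv. ring. }
    assert (Hright : forall l, (1 <= l)%nat ->
      cos w * chi_term (INR n) (2 * INR l - INR e) y =
      RInt (fun t => cos ((2 * INR l - INR e - INR n * y) * t)) 0 (PI / 2) +
      RInt (fun t => cos ((2 * INR l - INR e + INR n * y) * t)) 0 (PI / 2)).
    { intros l Hl.
      assert (Hp : 2 * INR l - INR e = INR (2 * l - e)).
      { rewrite minus_INR, mult_INR by lia. simpl. ring. }
      assert (2 * INR l - INR e - INR n * y <> 0)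
        by (rewrite Hp; now apply irrational_minus_neq0).
      assert (2 * INR l - INR e + INR n * y <> 0)
        by (rewrite Hp; now apply irrational_plus_neq0).
      rewrite !RInt_cos by assumption. unfold chi_term.
      set (p := 2 * INR l - INR e) in *.
      replace ((p - INR n * y) * (PI / 2)) with ((p - INR n) * (PI / 2) + w) by (unfold w; ring).
      replace ((p + INR n * y) * (PI / 2)) with ((p + INR n) * (PI / 2) - w) by (unfold w; ring).
      rewrite sin_plus, sin_minus.
      assert (cos ((p - INR n) * (PI / 2)) = 0) as ->.
      { rewrite Hnk. unfold p.
        replace ((2 * INR l - INR e - (2 * INR k - (1 - INR e))) * (PI / 2))
          with ((INR l - INR k - INR e) * PI + PI / 2) by field.
        rewrite cos_plus, cos_PI2. destruct (sin_PI_comb k l e) as [-> _]. ring. }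
      assert (cos ((p + INR n) * (PI / 2)) = 0) as ->.
      { rewrite Hnk. unfold p.
        replace ((2 * INR l - INR e + (2 * INR k - (1 - INR e))) * (PI / 2))
          with ((INR l + INR k - INR 0) * PI - PI / 2) by (simpl; field).
        rewrite cos_minus, cos_PI2. destruct (sin_PI_comb k l 0) as [_ ->]. ring. }
      field. now split. }
    rewrite Rmult_plus_distr_l, <- !psum_scal, <- psum_plus. apply psum_ext. intros l [Hl _].
    rewrite <- Hright by exact Hl.
    rewrite INR_pred_double, mult_INR by exact Hl. simpl (INR 2). simpl (INR 1).
    destruct He01 as [-> | ->].
    + specialize (Hwrong l). simpl (INR 0) in *. rewrite !Rminus_0_r in *.
      rewrite Hwrong. change (1 + 1) with 2. ring.
    + specialize (Hwrong l). simpl (INR 1) in *. rewrite Rminus_diag, Rminus_0_r in Hwrong.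
      change (1 + 1) with 2. rewrite Hwrong. ring.
Qed.

Lemma Rabs_sec (x : R) : Rabs (sec x) = / Rabs (cos x).
Proof. apply Rabs_inv. Qed.

(** Dominated convergence with the bound 8 on the kernels; the subtracted [s / y] is the total
    contribution of the terms [p = 0]. *)
Lemma weighted_chi_sum_lim (M : nat) (y s : R) :
  irrational y -> ex_series (fun n => Rabs (psi_term M ((y - 1) / 2) n)) ->
  is_lim_seq (sin_sum (M + 1)) s ->
  is_lim_seq (weighted_chi_sum M y) (PI / 2 * psi M ((y - 1) / 2) - / y * s).
Proof.
  intros Hy Hsum Hs. pose proof (irrational_neq0 y Hy) as Hy0.
  set (x := (y - 1) / 2) in *.
  set (f := fun L n => (/ INR n) ^ M * (sin (INR n * (PI / 2)) * / (INR n * y) + chi_sum (INR n) y L)).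
  assert (Hf : forall n, (1 <= n)%nat -> exists e, (e <= 1)%nat /\
    forall L, f L n = (sec (PI * INR n * x) / INR n ^ M) * kernel e L (INR n * y)).
  { intros n Hn. destruct (chi_sum_kernel n y Hy Hn) as [e [He Hk]].
    exists e. split; [exact He|]. intros L. rewrite <- Hk. unfold f, sec. fold x.
    pose proof (cos_neq0_irrational y n Hy Hn) as Hc. fold x in Hc.
    rewrite pow_inv.
    set (v := sin (INR n * (PI / 2)) * / (INR n * y) + chi_sum (INR n) y L).
    field. split; [exact Hc|]. apply pow_nonzero, not_0_INR. lia. }
  assert (Hlim : is_lim_seq (fun L => psum (f L) (2 * L)) (PI / 2 * psi M x)).
  { unfold psi. rewrite <- Series_scal_l.
    apply (tannery f (fun n => PI / 2 * (sec (PI * INR n * x) / INR n ^ M))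
      (fun n => 8 * Rabs (sec (PI * INR n * x) / INR n ^ M))).
    - intros L n Hn. destruct (Hf n Hn) as [e [He ->]].
      rewrite Rabs_mult, Rmult_comm. apply Rmult_le_compat_r; [apply Rabs_pos|].
      now apply kernel_bound.
    - apply (ex_series_scal_l 8 (fun n => Rabs (psi_term M x n))). exact Hsum.
    - intros n Hn. destruct (Hf n Hn) as [e [He Hfe]].
      eapply is_lim_seq_ext; [intros L; symmetry; apply Hfe|].
      rewrite (Rmult_comm (PI / 2)).
      apply (is_lim_seq_scal_l _ (sec (PI * INR n * x) / INR n ^ M) (PI / 2)).
      now apply kernel_lim. }
  assert (Hsy : is_lim_seq (fun L => / y * sin_sum (M + 1) L) (/ y * s)).
  { apply (is_lim_seq_scal_l _ (/ y) s Hs). }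
  eapply is_lim_seq_ext; [|exact (is_lim_seq_minus' _ _ _ _ Hlim Hsy)].
  intros L. unfold weighted_chi_sum, sin_sum.
  replace (psum (f L) (2 * L)) with
    (psum (fun n => (/ INR n) ^ M * chi_sum (INR n) y L) (2 * L) +
     / y * psum (fun n => sin (INR n * (PI / 2)) * (/ INR n) ^ (M + 1)) (2 * L)); [ring|].
  rewrite <- psum_scal, <- psum_plus. apply psum_ext. intros n Hn. unfold f.
  rewrite Nat.add_1_r, Rinv_mult. simpl. ring.
Qed.

Lemma pi_rational_lim_real (d : nat) (u : nat -> R) :
  pi_rational_lim d u -> exists x, rational x /\ real (Lim_seq u) = PI ^ d * x /\
    is_lim_seq u (real (Lim_seq u)).
Proof.
  intros [x [Hx Hu]]. exists x. rewrite (is_lim_seq_unique _ _ Hu). repeat split; assumption.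
Qed.

Lemma pi_rational_lim_correct (d : nat) (u : nat -> R) :
  pi_rational_lim d u -> is_lim_seq u (real (Lim_seq u)).
Proof. intros Hu. now destruct (pi_rational_lim_real d u Hu) as [x [_ [_ H]]]. Qed.

(** In the variable [y = 1 + 2 x], the map [x -> - x / (1 + 2 x)] is [y -> 1 / y]. *)
Lemma psi_functional_equation (m : nat) :
  (1 <= m)%nat ->
  exists (r : R) (c : nat -> R), rational r /\ (forall i, rational (c i)) /\
  forall y, irrational y -> irrational (/ y) ->
    ex_series (fun n => Rabs (psi_term (2 * m) ((y - 1) / 2) n)) ->
    ex_series (fun n => Rabs (psi_term (2 * m) ((/ y - 1) / 2) n)) ->
    y ^ (2 * m) * / y * psi (2 * m) ((/ y - 1) / 2) - psi (2 * m) ((y - 1) / 2) =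
    PI ^ (2 * m) * (r * (y ^ (2 * m) - / y) + psum (fun i => c i * y ^ (i - 1)) (2 * m)).
Proof.
  intros Hm. set (M := (2 * m)%nat).
  assert (HS : forall b, Nat.odd b = true -> pi_rational_lim b (sin_sum b)) by apply sin_sum_lim.
  assert (HC : forall a, Nat.even a = true -> (1 <= a)%nat -> pi_rational_lim a (cos_sum a))
    by apply cos_sum_lim.
  assert (HMe : Nat.even M = true) by (unfold M; apply Nat.even_mul).
  assert (Hpar : forall i, (i <= M)%nat -> Nat.odd (M + 1 - i) = Nat.even i).
  { intros i Hi. rewrite Nat.odd_sub by lia. rewrite Nat.add_1_r, Nat.odd_succ, HMe.
    rewrite <- Nat.negb_even. now destruct (Nat.even i). }
  set (s_lim := fun b => real (Lim_seq (sin_sum b))).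
  set (c_lim := fun a => real (Lim_seq (cos_sum a))).
  (* The factor [2 / PI^(M + 1)] clears both the [PI / 2] of the kernels and the weight; the value 0
     outside [1 <= i <= M] makes [c i] rational for every [i]. *)
  set (c := fun i => if andb (Nat.leb 1 i) (Nat.leb i M) then
    2 / PI ^ (M + 1) * (if Nat.odd i then -2 * (s_lim i * c_lim (M + 1 - i)%nat)
                        else 2 * (c_lim i * s_lim (M + 1 - i)%nat)) else 0).
  assert (HP : forall d, PI ^ d <> 0) by (intros d; apply pow_nonzero, PI_neq0).
  assert (HSM : Nat.odd (M + 1) = true) by (rewrite Nat.add_1_r, Nat.odd_succ; exact HMe).
  destruct (pi_rational_lim_real _ _ (HS (M + 1)%nat HSM)) as [s [Hs [HsE HsL]]].
  (* The [p = 0] terms at [y] and at [1 / y], divided by [PI / 2]. *)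
  exists (2 * s), c. split; [auto with rat|]. split.
  { intros i. unfold c. destruct (Nat.leb_spec 1 i), (Nat.leb_spec i M); simpl;
      try apply rational_IZR.
    pose proof (Hpar i ltac:(lia)) as Hp. destruct (Nat.odd i) eqn:Ho.
    - destruct (pi_rational_lim_real _ _ (HS i Ho)) as [s1 [Hs1 [E1 _]]].
      assert (Nat.even (M + 1 - i) = true) as Hev.
      { rewrite <- Nat.negb_odd, Hp, <- Nat.negb_odd, Ho. reflexivity. }
      destruct (pi_rational_lim_real _ _ (HC _ Hev ltac:(lia))) as [s2 [Hs2 [E2 _]]].
      unfold s_lim, c_lim. rewrite E1, E2.
      replace (2 / PI ^ (M + 1) * (-2 * (PI ^ i * s1 * (PI ^ (M + 1 - i) * s2))))
        with (-4 * (s1 * s2)); [auto with rat|].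
      replace (M + 1)%nat with (i + (M + 1 - i))%nat at 1 by lia. rewrite pow_add.
      field. split; apply HP.
    - rewrite <- Nat.negb_odd, Ho in Hp. simpl in Hp.
      assert (Nat.even i = true) as Hev by (rewrite <- Nat.negb_odd, Ho; reflexivity).
      destruct (pi_rational_lim_real _ _ (HS _ Hp)) as [s1 [Hs1 [E1 _]]].
      destruct (pi_rational_lim_real _ _ (HC _ Hev ltac:(lia))) as [s2 [Hs2 [E2 _]]].
      unfold s_lim, c_lim. rewrite E1, E2.
      replace (2 / PI ^ (M + 1) * (2 * (PI ^ i * s2 * (PI ^ (M + 1 - i) * s1))))
        with (4 * (s1 * s2)); [auto with rat|].
      replace (M + 1)%nat with (i + (M + 1 - i))%nat at 1 by lia. rewrite pow_add.
      field. split; apply HP. }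
  intros y Hy Hy' Hsum Hsum'. pose proof (irrational_neq0 y Hy) as Hy0.
  pose proof (weighted_chi_sum_lim M y _ Hy Hsum HsL) as L1.
  pose proof (weighted_chi_sum_lim M (/ y) _ Hy' Hsum' HsL) as L2.
  rewrite Rinv_inv in L2.
  apply (is_lim_seq_scal_l _ (y ^ M * / y)) in L2. simpl in L2.
  pose proof (is_lim_seq_minus' _ _ _ _ L2 L1) as L3.
  eapply is_lim_seq_ext in L3; [|intros L; apply weighted_chi_sum_reciprocity; exact Hy].
  assert (L4 : is_lim_seq (fun L => psum (fun i => y ^ (i - 1) *
    (if Nat.odd i then -2 * (sin_sum i L * cos_sum (2 * m + 1 - i) L)
     else 2 * (cos_sum i L * sin_sum (2 * m + 1 - i) L))) (2 * m))
    (psum (fun i => PI ^ (M + 1) / 2 * (c i * y ^ (i - 1))) M)).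
  { apply is_lim_seq_psum. intros i Hi. fold M in Hi |- *.
    unfold c. rewrite (proj2 (Nat.leb_le 1 i)), (proj2 (Nat.leb_le i M)) by lia. simpl andb.
    cbv iota. pose proof (Hpar i ltac:(lia)) as Hp.
    match goal with |- is_lim_seq _ (Finite (_ * (2 / _ * ?X * _))) =>
      replace (PI ^ (M + 1) / 2 * (2 / PI ^ (M + 1) * X * y ^ (i - 1))) with (y ^ (i - 1) * X)
        by (field; apply HP) end.
    apply (is_lim_seq_scal_l _ (y ^ (i - 1)) (Finite _)).
    destruct (Nat.odd i) eqn:Ho.
    - assert (Nat.even (M + 1 - i) = true) as Hev.
      { rewrite <- Nat.negb_odd, Hp, <- Nat.negb_odd, Ho. reflexivity. }
      apply (is_lim_seq_scal_l _ (-2) (Finite _)).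
      apply is_lim_seq_mult'; [apply (pi_rational_lim_correct _ _ (HS i Ho))
        |apply (pi_rational_lim_correct _ _ (HC _ Hev ltac:(lia)))].
    - rewrite <- Nat.negb_odd, Ho in Hp. simpl in Hp.
      assert (Nat.even i = true) as Hev by (rewrite <- Nat.negb_odd, Ho; reflexivity).
      apply (is_lim_seq_scal_l _ 2 (Finite _)).
      apply is_lim_seq_mult'; [apply (pi_rational_lim_correct _ _ (HC i Hev ltac:(lia)))
        |apply (pi_rational_lim_correct _ _ (HS _ Hp))]. }
  apply is_lim_seq_unique in L3. apply is_lim_seq_unique in L4. rewrite L3 in L4.
  injection L4 as E. rewrite psum_scal, HsE in E.
  rewrite Nat.add_1_r in E. simpl (PI ^ S M) in E.
  set (Sig := psum (fun i => c i * y ^ (i - 1)) M) in *. fold M.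
  set (p1 := psi M ((/ y - 1) / 2)) in *. set (p2 := psi M ((y - 1) / 2)) in *.
  apply (Rmult_eq_reg_l (PI / 2)); [|pose proof PI_RGT_0; lra].
  replace (PI / 2 * (y ^ M * / y * p1 - p2)) with
    (y ^ M * / y * (PI / 2 * p1 - y * (PI * PI ^ M * s)) - (PI / 2 * p2 - / y * (PI * PI ^ M * s))
     + (PI * PI ^ M * s) * (y ^ M - / y)) by (field; exact Hy0).
  rewrite E. field. exact Hy0.
Qed.

(** * Summability at badly approximable numbers *)

(** Lists, because the integers to be summed over arise in no particular order and only their
    distinctness is known. *)
Definition lsum {A : Type} (g : A -> R) (l : list A) : R := fold_right (fun z a => g z + a) 0 l.

Lemma lsum_app {A : Type} (g : A -> R) (l1 l2 : list A) :
  lsum g (l1 ++ l2) = lsum g l1 + lsum g l2.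
Proof. induction l1 as [|a l1 IH]; simpl; [ring|rewrite IH; ring]. Qed.

Lemma lsum_incl {A : Type} (g : A -> R) (l l' : list A) :
  (forall z, 0 <= g z) -> NoDup l -> incl l l' -> lsum g l <= lsum g l'.
Proof.
  intros Hg. revert l'. induction l as [|a l IH]; intros l' Hnd Hinc.
  - clear Hnd Hinc. induction l' as [|b l' IH']; simpl in *; [lra|]. specialize (Hg b). lra.
  - inversion Hnd as [|? ? Ha Hl]; subst.
    destruct (in_split a l' (Hinc a (or_introl eq_refl))) as [l1 [l2 ->]].
    assert (H : incl l (l1 ++ l2)).
    { intros z Hz. assert (Hz' := Hinc z (or_intror Hz)).
      apply in_app_or in Hz'. apply in_or_app. destruct Hz' as [Hz'|[Hz'|Hz']]; auto.
      subst. contradiction. }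
    specialize (IH _ Hl H). rewrite lsum_app in *. simpl. lra.
Qed.

Lemma lsum_map_seq {A : Type} (g : A -> R) (f : nat -> A) (N : nat) :
  lsum g (map f (seq 1 N)) = psum (fun n => g (f n)) N.
Proof.
  induction N as [|N IH]; [reflexivity|].
  rewrite seq_S, map_app, lsum_app, IH. simpl. ring.
Qed.

(** A square root in place of the logarithm: the resulting growth exponent 3/2 is still below 2. *)
Lemma harmonic_le_sqrt (F : nat) : psum (fun n => / INR n) F <= 2 * sqrt (INR F).
Proof.
  induction F as [|F IH]; cbn [psum].
  - simpl. rewrite sqrt_0. lra.
  - pose proof (pos_INR F) as HF. rewrite S_INR.
    pose proof (sqrt_sqrt (INR F) HF). pose proof (sqrt_sqrt (INR F + 1) ltac:(lra)).
    pose proof (sqrt_pos (INR F)). pose proof (sqrt_pos (INR F + 1)).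
    set (a := sqrt (INR F)) in *. set (b := sqrt (INR F + 1)) in *.
    assert (Hab : a <= b) by (apply sqrt_le_1; lra).
    assert (Hb : 1 <= b) by nra.
    replace (INR F + 1) with (b * b) by assumption.
    assert (/ (b * b) <= 2 * (b - a)); [|lra].
    apply (Rmult_le_reg_l (b * b)); [nra|]. rewrite Rinv_r by nra.
    assert (Hd : (b - a) * (b + a) = 1) by lra. nra.
Qed.

(* Abel summation, with the increments of [- 4 / sqrt n] dominating the summands. *)
Lemma ex_series_abel_32 (a : nat -> R) (C : R) :
  (forall n, (1 <= n)%nat -> 0 <= a n) ->
  (forall N, psum a N <= C * (INR N * sqrt (INR N))) ->
  ex_series (fun n => a (S n) / INR (S n) ^ 2).
Proof.
  intros Ha HS.
  assert (HC : 0 <= C).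
  { pose proof (HS 1%nat) as H. simpl in H. rewrite sqrt_1 in H.
    pose proof (Ha 1%nat ltac:(lia)). lra. }
  (* The first term on the right is the boundary term of the summation by parts; carrying it along
     lets the induction close. *)
  assert (HT : forall N, psum (fun n => a n / INR n ^ 2) N <=
    psum a N / (INR N + 1) ^ 2 + 4 * C * (1 - / sqrt (INR N + 1))).
  { induction N as [|N IH]; cbn [psum].
    - simpl. rewrite Rplus_0_l, sqrt_1, Rinv_1. lra.
    - specialize (HS (S N)). cbn [psum] in HS. rewrite S_INR in *.
      set (s := psum a N) in *. set (u := a (S N)) in *.
      pose proof (pos_INR N). set (n := INR N + 1) in *.
      assert (Hn : 1 <= n) by (unfold n; lra).
      pose proof (sqrt_sqrt n ltac:(lra)). pose proof (sqrt_sqrt (n + 1) ltac:(lra)).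
      pose proof (sqrt_lt_R0 n ltac:(lra)). pose proof (sqrt_lt_R0 (n + 1) ltac:(lra)).
      assert (sqrt n <= sqrt (n + 1)) by (apply sqrt_le_1; lra).
      set (p := sqrt n) in *. set (q := sqrt (n + 1)) in *.
      assert (Hkey : (s + u) * (/ n ^ 2 - / (n + 1) ^ 2) <= 4 * C * (/ p - / q)).
      { apply Rle_trans with (C * (n * p) * (/ n ^ 2 - / (n + 1) ^ 2)).
        - apply Rmult_le_compat_r; [|exact HS].
          assert (/ (n + 1) ^ 2 <= / n ^ 2); [|lra]. apply Rinv_le_contravar; nra.
        - replace (C * (n * p) * (/ n ^ 2 - / (n + 1) ^ 2))
            with (C * (p * (2 * n + 1) / (n * (n + 1) ^ 2))) by (field; lra).
          replace (4 * C * (/ p - / q)) with (C * (4 * (/ p - / q))) by ring.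
          apply Rmult_le_compat_l; [exact HC|].
          apply Rle_trans with (2 / (p * (n + 1))).
          + apply Rle_trans with (p * (2 * (n + 1)) / (n * (n + 1) ^ 2)).
            * apply Rmult_le_compat_r; [left; apply Rinv_0_lt_compat; nra|]. nra.
            * right. replace n with (p * p) by assumption. field. split; nra.
          + replace (4 * (/ p - / q)) with (4 * ((q - p) * (q + p)) / (p * q * (q + p)))
              by (field; lra).
            replace ((q - p) * (q + p)) with 1 by lra.
            replace (n + 1) with (q * q) by assumption.
            apply Rle_trans with (4 / (p * q * (q + q))).
            * right. field. lra.
            * rewrite Rmult_1_r. apply Rmult_le_compat_l; [lra|].
              apply Rinv_le_contravar; [repeat apply Rmult_lt_0_compat; lra|].
              apply Rmult_le_compat_l; [nra|lra]. }
      unfold Rdiv in *. nra. }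
  apply (ex_series_bounded_psum (fun n => a n / INR n ^ 2) (5 * C)).
  - intros n Hn. apply Rmult_le_pos; [now apply Ha|].
    left. apply Rinv_0_lt_compat, pow_lt, lt_0_INR. lia.
  - intros N. eapply Rle_trans; [apply HT|].
    pose proof (pos_INR N). specialize (HS N).
    pose proof (sqrt_lt_R0 (INR N + 1) ltac:(lra)) as Hq.
    pose proof (Rinv_0_lt_compat _ Hq).
    assert (psum a N / (INR N + 1) ^ 2 <= C); [|nra].
    apply Rle_div_l; [nra|]. eapply Rle_trans; [exact HS|].
    apply Rmult_le_compat_l; [exact HC|].
    assert (sqrt (INR N) <= INR N + 1).
    { pose proof (sqrt_sqrt (INR N) ltac:(lra)). pose proof (sqrt_pos (INR N)). nra. }
    pose proof (sqrt_pos (INR N)). nra.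
Qed.

Definition badly_approximable (x : R) : Prop :=
  exists c, 0 < c /\ forall u v : Z, v <> 0%Z -> c / Rabs (IZR v) <= Rabs (IZR u - IZR v * x).

(** The signed distance from [n x] to the half-integer of its unit interval, that is to the nearest
    zero of [cos (PI t)]. *)
Definition half_gap (x : R) (n : nat) : R := / 2 + IZR (Int_part (INR n * x)) - INR n * x.

Lemma half_gap_range (x : R) (n : nat) : Rabs (half_gap x n) <= / 2.
Proof. unfold half_gap. destruct (base_Int_part (INR n * x)). apply Rabs_le. lra. Qed.

Lemma half_gap_le_cos (x : R) (n : nat) : Rabs (half_gap x n) <= Rabs (cos (PI * INR n * x)).
Proof.
  pose proof (half_gap_range x n) as Hr. pose proof PI2_3_2 as HPI.
  apply Rle_trans with (Rabs (sin (PI * half_gap x n))).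
  - assert (H : Rabs (half_gap x n) <= sin (PI * Rabs (half_gap x n))).
    { pose proof (Rabs_pos (half_gap x n)).
      eapply Rle_trans; [|apply sin_ge_third; split; nra]. nra. }
    unfold Rabs in *. destruct (Rcase_abs (half_gap x n)).
    + rewrite Ropp_mult_distr_r_reverse, sin_neg in H.
      destruct (Rcase_abs (sin (PI * half_gap x n))); lra.
    + destruct (Rcase_abs (sin (PI * half_gap x n))); lra.
  - unfold half_gap. set (k := Int_part (INR n * x)).
    replace (PI * (/ 2 + IZR k - INR n * x)) with (PI / 2 + (IZR k * PI - PI * INR n * x)) by field.
    rewrite <- cos_sin. rewrite cos_minus.
    rewrite (sin_eq_0_1 (IZR k * PI)) by (exists k; reflexivity).
    rewrite Rmult_0_l, Rplus_0_r, Rabs_mult.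
    assert (Rabs (cos (IZR k * PI)) <= 1) by (apply Rabs_le, COS_bound).
    pose proof (Rabs_pos (cos (PI * INR n * x))). nra.
Qed.

(** A half-integer is a fraction of denominator 2, so bad approximability is used with denominator
    [2 n]. *)
Lemma half_gap_lower (x c : R) (N n : nat) :
  0 < c -> (forall u v : Z, v <> 0%Z -> c / Rabs (IZR v) <= Rabs (IZR u - IZR v * x)) ->
  (1 <= n <= N)%nat -> c / (4 * INR N) <= Rabs (half_gap x n).
Proof.
  intros Hc H Hn. set (k := Int_part (INR n * x)).
  specialize (H (2 * k + 1)%Z (2 * Z.of_nat n)%Z ltac:(lia)).
  rewrite plus_IZR, !mult_IZR, <- INR_IZR_INZ in H.
  replace (2 * IZR k + 1 - 2 * INR n * x) with (2 * half_gap x n) in H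
    by (unfold half_gap; fold k; field).
  assert (1 <= INR n <= INR N) as HnR.
  { split; [apply (le_INR 1)|apply le_INR]; lia. }
  rewrite (Rabs_mult 2 (half_gap x n)), (Rabs_pos_eq 2), (Rabs_pos_eq (2 * INR n)) in H by lra.
  assert (c / (4 * INR N) <= c / (4 * INR n)).
  { apply Rmult_le_compat_l; [lra|]. apply Rinv_le_contravar; lra. }
  replace (c / (2 * INR n)) with (2 * (c / (4 * INR n))) in H by (field; lra). lra.
Qed.

(** The half-integers cancel up to an integer, and bad approximability applies with denominator
    [n - n'], smaller than [N] in absolute value. *)
Lemma half_gap_separated (x c : R) (N n n' : nat) :
  0 < c -> (forall u v : Z, v <> 0%Z -> c / Rabs (IZR v) <= Rabs (IZR u - IZR v * x)) ->
  (1 <= n <= N)%nat -> (1 <= n' <= N)%nat -> n <> n' ->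
  c / (4 * INR N) < Rabs (half_gap x n - half_gap x n').
Proof.
  intros Hc H Hn Hn' Hne.
  specialize (H (Int_part (INR n * x) - Int_part (INR n' * x))%Z (Z.of_nat n - Z.of_nat n')%Z
    ltac:(lia)).
  rewrite !minus_IZR, <- !INR_IZR_INZ in H.
  replace (IZR (Int_part (INR n * x)) - IZR (Int_part (INR n' * x)) - (INR n - INR n') * x)
    with (half_gap x n - half_gap x n') in H by (unfold half_gap; ring).
  assert (1 <= INR n <= INR N) as HnR.
  { split; [apply (le_INR 1)|apply le_INR]; lia. }
  assert (1 <= INR n' <= INR N) as HnR'.
  { split; [apply (le_INR 1)|apply le_INR]; lia. }
  eapply Rlt_le_trans; [|exact H].
  apply Rmult_lt_compat_l; [exact Hc|]. apply Rinv_lt_contravar.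
  - apply Rmult_lt_0_compat; [|lra]. apply Rabs_pos_lt.
    intros H0. apply Hne, INR_eq. lra.
  - apply Rle_lt_trans with (INR N); [apply Rabs_le|]; lra.
Qed.

(* The values [half_gap x n / s], for a spacing [s] of order [1 / N], have distinct
   nonzero integer parts, so the sum of their inverses is at most twice a harmonic sum. *)
Lemma sec_sum_bound (x : R) :
  badly_approximable x ->
  exists C, forall N, psum (fun n => Rabs (sec (PI * INR n * x))) N <= C * (INR N * sqrt (INR N)).
Proof.
  intros [c [Hc H]].
  (* Chosen so that [/ 2 / s + 1], which is [2 N / c + 1], stays below [(K + 1) N]; this bounds all
     the integer parts. *)
  destruct (nfloor_ex (2 / c + 1)) as [K [_ HK]].
  { assert (0 < 2 / c) by (apply Rdiv_lt_0_compat; lra). lra. }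
  (* The product of [2 / s = 8 N / c] and two harmonic sums up to [(K + 1) N], each at most twice a
     square root. *)
  exists (32 / c * sqrt (INR (S K))). intros N.
  destruct N as [|N']; [simpl; lra|]. set (N := S N').
  assert (HN : 1 <= INR N) by (apply (le_INR 1); unfold N; lia).
  set (s := c / (4 * INR N)).
  assert (Hs : 0 < s) by (apply Rdiv_lt_0_compat; lra).
  set (z := fun n => Int_part (half_gap x n / s)).
  (* The quotient has absolute value at least 1, so its integer part is not 0; rounding down a
     negative number adds less than 1 to its absolute value, hence at most doubles it. *)
  assert (Hz : forall n, (1 <= n <= N)%nat ->
    z n <> 0%Z /\ Rabs (IZR (z n)) <= 2 * Rabs (half_gap x n) / s /\
    Rabs (IZR (z n)) <= Rabs (half_gap x n) / s + 1).
  { intros n Hn. pose proof (half_gap_lower x c N n Hc H Hn) as Hl. fold s in Hl.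
    destruct (base_Int_part (half_gap x n / s)) as [Hz1 Hz2]. fold (z n) in Hz1, Hz2.
    set (t := half_gap x n) in *.
    assert (Ht : 1 <= Rabs (t / s)).
    { unfold Rdiv. rewrite Rabs_mult, (Rabs_pos_eq (/ s)) by (left; now apply Rinv_0_lt_compat).
      apply (Rmult_le_reg_r s); [exact Hs|]. rewrite Rmult_assoc, Rinv_l; lra. }
    replace (2 * Rabs t / s) with (2 * Rabs (t / s)).
    2: { unfold Rdiv. rewrite Rabs_mult, (Rabs_pos_eq (/ s)) by (left; now apply Rinv_0_lt_compat).
         ring. }
    replace (Rabs t / s) with (Rabs (t / s)).
    2: { unfold Rdiv. now rewrite Rabs_mult, (Rabs_pos_eq (/ s)) by (left; now apply Rinv_0_lt_compat). }
    set (w := t / s) in *. split; [|split].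
    - intros H0. rewrite H0 in *. unfold Rabs in Ht. destruct (Rcase_abs w); lra.
    - apply Rabs_le. unfold Rabs in *. destruct (Rcase_abs w); lra.
    - apply Rabs_le. unfold Rabs in *. destruct (Rcase_abs w); lra. }
  set (F := (S K * N)%nat).
  set (g := fun k : Z => / Rabs (IZR k)).
  set (l := map z (seq 1 N)).
  set (l' := map Z.of_nat (seq 1 F) ++ map (fun n => (- Z.of_nat n)%Z) (seq 1 F)).
  assert (Hg : forall k, 0 <= g k).
  { intros k. unfold g. destruct (Req_dec (Rabs (IZR k)) 0) as [->|Hk]; [rewrite Rinv_0; lra|].
    left. apply Rinv_0_lt_compat. pose proof (Rabs_pos (IZR k)). lra. }
  assert (Hnd : NoDup l).
  { apply NoDup_map_NoDup_ForallPairs; [|apply seq_NoDup].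
    intros n n' Hn Hn' Hzz. apply in_seq in Hn, Hn'.
    destruct (Nat.eq_dec n n') as [->|Hne]; [reflexivity|exfalso].
    pose proof (half_gap_separated x c N n n' Hc H ltac:(lia) ltac:(lia) Hne) as Hsep. fold s in Hsep.
    destruct (base_Int_part (half_gap x n / s)) as [Hz1 Hz2]. fold (z n) in Hz1, Hz2.
    destruct (base_Int_part (half_gap x n' / s)) as [Hz1' Hz2']. fold (z n') in Hz1', Hz2'.
    rewrite Hzz in *.
    assert (Hlt : Rabs (half_gap x n / s - half_gap x n' / s) < 1) by (apply Rabs_def1; lra).
    replace (half_gap x n / s - half_gap x n' / s) with ((half_gap x n - half_gap x n') * / s)
      in Hlt by (field; lra).
    rewrite Rabs_mult, (Rabs_pos_eq (/ s)) in Hlt by (left; now apply Rinv_0_lt_compat).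
    apply (Rmult_lt_compat_r s) in Hlt; [|exact Hs].
    rewrite Rmult_assoc, Rinv_l in Hlt; lra. }
  assert (Hinc : incl l l').
  { intros k Hk. apply in_map_iff in Hk. destruct Hk as [n [<- Hn]]. apply in_seq in Hn.
    destruct (Hz n ltac:(lia)) as [Hz0 [_ Hz1]].
    assert (HzF : Rabs (IZR (z n)) < INR F).
    { eapply Rle_lt_trans; [exact Hz1|]. pose proof (half_gap_range x n).
      apply Rle_lt_trans with (/ 2 / s + 1).
      - apply Rplus_le_compat_r, Rmult_le_compat_r; [left; now apply Rinv_0_lt_compat|assumption].
      - unfold s, F. rewrite mult_INR, S_INR.
        replace (/ 2 / (c / (4 * INR N)) + 1) with (2 / c * INR N + 1) by (field; lra). nra. }
    rewrite <- abs_IZR, INR_IZR_INZ in HzF. apply lt_IZR in HzF.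
    apply in_or_app. destruct (Z.lt_ge_cases 0 (z n)) as [Hpos|Hneg].
    - left. apply in_map_iff. exists (Z.to_nat (z n)). split; [lia|]. apply in_seq. lia.
    - right. apply in_map_iff. exists (Z.to_nat (- z n)). split; [lia|]. apply in_seq. lia. }
  pose proof (lsum_incl g l l' Hg Hnd Hinc) as Hsum.
  unfold l, l' in Hsum. rewrite lsum_app, !lsum_map_seq in Hsum.
  rewrite (psum_ext (fun n => g (Z.of_nat n)) (fun n => / INR n)) in Hsum.
  2: { intros n _. unfold g. rewrite <- INR_IZR_INZ, Rabs_pos_eq; [reflexivity|apply pos_INR]. }
  rewrite (psum_ext (fun n => g (- Z.of_nat n)%Z) (fun n => / INR n)) in Hsum.
  2: { intros n _. unfold g.
       rewrite opp_IZR, Rabs_Ropp, <- INR_IZR_INZ, Rabs_pos_eq; [reflexivity|apply pos_INR]. }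
  pose proof (harmonic_le_sqrt F) as HF.
  unfold F in HF at 2. rewrite mult_INR, sqrt_mult in HF by apply pos_INR.
  apply Rle_trans with (psum (fun n => 2 / s * g (z n)) N).
  - apply psum_le. intros n Hn. rewrite Rabs_sec.
    destruct (Hz n Hn) as [Hz0 [Hz1 _]].
    pose proof (half_gap_lower x c N n Hc H Hn) as Hl. fold s in Hl.
    pose proof (half_gap_le_cos x n) as Hcos.
    assert (Hzp : 0 < Rabs (IZR (z n))) by (apply Rabs_pos_lt, eq_IZR_contrapositive; exact Hz0).
    apply Rle_trans with (/ Rabs (half_gap x n)).
    + apply Rinv_le_contravar; lra.
    + unfold g. replace (2 / s * / Rabs (IZR (z n))) with (/ (s * Rabs (IZR (z n)) / 2)).
      2: { field. lra. }
      apply Rinv_le_contravar; [apply Rdiv_lt_0_compat; [nra|lra]|].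
      apply (Rmult_le_compat_l s) in Hz1; [|lra].
      replace (s * (2 * Rabs (half_gap x n) / s)) with (2 * Rabs (half_gap x n)) in Hz1
        by (field; lra). lra.
  - rewrite psum_scal.
    apply Rle_trans with (2 / s * (4 * (sqrt (INR (S K)) * sqrt (INR N)))).
    + apply Rmult_le_compat_l; [left; apply Rdiv_lt_0_compat; lra|lra].
    + unfold s. right. field. lra.
Qed.

Lemma ex_series_psi_term_Rabs (x : R) (s : nat) :
  (2 <= s)%nat ->
  (exists C, forall N, psum (fun n => Rabs (sec (PI * INR n * x))) N <= C * (INR N * sqrt (INR N))) ->
  ex_series (fun n => Rabs (psi_term s x n)).
Proof.
  intros Hs [C HC].
  apply (ex_series_le (fun n => Rabs (psi_term s x n)) (fun n => Rabs (sec (PI * INR (S n) * x)) / INR (S n) ^ 2)).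
  - intros n. change (norm ?r) with (Rabs r). unfold psi_term, Rdiv.
    rewrite Rabs_Rabsolu, Rabs_mult.
    apply Rmult_le_compat_l; [apply Rabs_pos|].
    assert (Hn : 1 <= INR (S n)) by (apply (le_INR 1); lia).
    rewrite Rabs_pos_eq by (left; apply Rinv_0_lt_compat, pow_lt; lra).
    apply Rinv_le_contravar; [apply pow_lt; lra|]. now apply Rle_pow.
  - apply (ex_series_abel_32 (fun n => Rabs (sec (PI * INR n * x))) C); [|exact HC].
    intros n _. apply Rabs_pos.
Qed.

(** * Pell's equation and quadratic irrationals *)

Definition nonsquare (k : Z) : Prop := forall p q : Z, (p * p = k * (q * q))%Z -> q = 0%Z.

(* Descent: a solution [(p, q)] yields [(k q - l p, p - l q)], where [l ^ 2 < k < (l + 1) ^ 2]. *)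
Lemma nonsquare_intro (k : Z) :
  (0 < k)%Z -> (forall l : Z, (0 <= l)%Z -> (l * l)%Z <> k) -> nonsquare k.
Proof.
  intros Hk H. destruct (Z.sqrt_spec k ltac:(lia)) as [H1 H2]. unfold Z.succ in H2.
  pose proof (Z.sqrt_nonneg k) as Hl0. specialize (H _ Hl0). set (l := Z.sqrt k) in *.
  assert (Hpos : forall n p q : Z, (0 <= n)%Z -> (0 <= p)%Z -> (0 < q <= n)%Z ->
    (p * p)%Z <> (k * (q * q))%Z).
  { intros n p q Hn. revert p q. pattern n. apply natlike_ind; [lia| |exact Hn].
    clear n Hn. intros n Hn IH p q Hp Hq E.
    assert (l * q < p)%Z by nia.
    assert (p < (l + 1) * q)%Z by nia.
    apply (IH (k * q - l * p)%Z (p - l * q)%Z); [nia|lia|nia]. }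
  intros p q E. destruct (Z.eq_dec q 0) as [Hq|Hq]; [exact Hq|exfalso].
  apply (Hpos (Z.abs q) (Z.abs p) (Z.abs q)); [lia|lia|lia|].
  rewrite <- !Z.abs_mul, E. rewrite !Z.abs_mul. rewrite (Z.abs_eq k) by lia. reflexivity.
Qed.

(** The triple [(A, B, C)] stands for the binary quadratic form [A X^2 + B X Y + C Y^2] and
    [river_step] for a step along its Conway river: the basis vector whose value has the sign
    of [A + B + C] is replaced by the sum of both basis vectors. *)
Definition river_step (s : Z * Z * Z) : Z * Z * Z :=
  let '(A, B, C) := s in
  if (0 <? A + B + C)%Z then (A + B + C, B + 2 * C, C)%Z else (A, B + 2 * A, A + B + C)%Z.

Definition on_river (k : Z) (s : Z * Z * Z) : Prop :=
  let '(A, B, C) := s in (0 < A)%Z /\ (C < 0)%Z /\ (B * B - 4 * A * C = 4 * k)%Z.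

(** If [A + B + C] were 0, then [(2 A + B)^2] would equal the discriminant [4 k]. *)
Lemma on_river_step (k : Z) (s : Z * Z * Z) :
  nonsquare k -> on_river k s -> on_river k (river_step s).
Proof.
  intros Hk. destruct s as [[A B] C]. unfold on_river, river_step. intros [HA [HC HD]].
  assert (HS : (A + B + C <> 0)%Z).
  { intros HS. assert (2 = 0)%Z; [|lia]. apply (Hk (2 * A + B)%Z 2%Z). nia. }
  destruct (Z.ltb_spec 0 (A + B + C)); repeat split; try lia; nia.
Qed.

(** The branch can be read off the image: there [A - B + C] is the old [A], positive, or the old
    [C], negative. *)
Lemma river_step_inj (k : Z) (s s' : Z * Z * Z) :
  on_river k s -> on_river k s' -> river_step s = river_step s' -> s = s'.
Proof.
  destruct s as [[A B] C], s' as [[A' B'] C']. unfold on_river, river_step. intros [HA [HC _]] [HA' [HC' _]].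
  destruct (Z.ltb_spec 0 (A + B + C)), (Z.ltb_spec 0 (A' + B' + C')); intros E;
    apply pair_equal_spec in E as [E E3]; apply pair_equal_spec in E as [E1 E2];
    (assert (A = A' /\ B = B' /\ C = C')%Z as [-> [-> ->]] by lia; reflexivity).
Qed.

Definition zrange (n : nat) : list Z := map (fun i => (Z.of_nat i - Z.of_nat n)%Z) (seq 0 (2 * n + 1)).

Lemma in_zrange (n : nat) (z : Z) : (Z.abs z <= Z.of_nat n)%Z -> In z (zrange n).
Proof.
  intros Hz. apply in_map_iff. exists (Z.to_nat (z + Z.of_nat n)).
  split; [lia|]. apply in_seq. lia.
Qed.

(** [B^2] and [- 4 A C] are nonnegative with sum [4 k], so only finitely many states exist. *)
Lemma on_river_bounded (k : Z) (s : Z * Z * Z) :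
  on_river k s -> In s (list_prod (list_prod (zrange (Z.to_nat (4 * k))) (zrange (Z.to_nat (4 * k))))
                          (zrange (Z.to_nat (4 * k)))).
Proof.
  destruct s as [[A B] C]. intros [HA [HC HD]].
  assert (0 <= 4 * k)%Z by nia.
  repeat apply in_prod; apply in_zrange; rewrite Z2Nat.id by assumption; nia.
Qed.

(** An injective map on a finite set returns to its starting point. *)
Lemma river_periodic (k : Z) (s : Z * Z * Z) :
  nonsquare k -> on_river k s -> exists j, (1 <= j)%nat /\ Nat.iter j river_step s = s.
Proof.
  intros Hk Hs. apply NNPP. intros Hno.
  assert (Hon : forall i, on_river k (Nat.iter i river_step s)).
  { induction i as [|i IH]; [exact Hs|]. simpl. now apply on_river_step. }
  assert (Hinj : forall i d, Nat.iter i river_step s = Nat.iter (i + d) river_step s -> d = 0%nat).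
  { induction i as [|i IH]; intros d E.
    - destruct d as [|d]; [reflexivity|exfalso]. apply Hno. exists (S d). split; [lia|].
      symmetry. exact E.
    - apply IH. apply (river_step_inj k); auto. }
  set (l := list_prod (list_prod (zrange (Z.to_nat (4 * k))) (zrange (Z.to_nat (4 * k))))
                          (zrange (Z.to_nat (4 * k)))).
  assert (Hnd : NoDup (map (fun i => Nat.iter i river_step s) (seq 0 (S (length l))))).
  { apply NoDup_map_NoDup_ForallPairs; [|apply seq_NoDup].
    intros i j _ _ E. destruct (Nat.le_ge_cases i j) as [Hij|Hij].
    - specialize (Hinj i (j - i)%nat). replace (i + (j - i))%nat with j in Hinj by lia.
      specialize (Hinj E). lia.
    - specialize (Hinj j (i - j)%nat). replace (j + (i - j))%nat with i in Hinj by lia.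
      symmetry in E. specialize (Hinj E). lia. }
  apply NoDup_incl_length with (l' := l) in Hnd.
  - rewrite length_map, length_seq in Hnd. lia.
  - intros z Hz. apply in_map_iff in Hz. destruct Hz as [i [<- _]]. now apply on_river_bounded.
Qed.

(** Each state is [X^2 - k Y^2] written in a basis [(a, c)], [(b, d)] with nonnegative entries. The
    growing sum of the entries shows that a later return to the initial form happens in a different
    basis. *)
Lemma river_basis (k : Z) (i : nat) :
  exists a b c d : Z, (0 <= a /\ 0 <= b /\ 0 <= c /\ 0 <= d /\ 1 <= a + c /\ 1 <= b + d /\
    2 + Z.of_nat i <= a + b + c + d)%Z /\
    Nat.iter i river_step (1, 0, - k)%Z =
    (a * a - k * (c * c), 2 * (a * b - k * (c * d)), b * b - k * (d * d))%Z.
Proof.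
  induction i as [|i IH].
  - exists 1%Z, 0%Z, 0%Z, 1%Z. split; [lia|]. 
    cbn [Nat.iter]. apply pair_equal_spec. split; [apply pair_equal_spec; split|]; ring.
  - destruct IH as [a [b [c [d [Hpos E]]]]]. simpl Nat.iter. rewrite E. unfold river_step.
    destruct (0 <? _)%Z.
    + exists (a + b)%Z, b, (c + d)%Z, d. split; [lia|]. apply pair_equal_spec. split; [apply pair_equal_spec; split|]; ring.
    + exists a, (a + b)%Z, c, (c + d)%Z. split; [lia|]. apply pair_equal_spec. split; [apply pair_equal_spec; split|]; ring.
Qed.

Lemma pell (k : Z) :
  (0 < k)%Z -> nonsquare k -> exists a c : Z, (a * a - k * (c * c) = 1)%Z /\ a <> 0%Z /\ c <> 0%Z.
Proof.
  intros Hk0 Hk.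
  destruct (river_periodic k (1, 0, - k)%Z Hk) as [j [Hj E]]; [unfold on_river; lia|].
  destruct (river_basis k j) as [a [b [c [d [Hpos E']]]]].
  rewrite E in E'.
  apply pair_equal_spec in E' as [E' E3]. apply pair_equal_spec in E' as [E1 E2].
  (* If [c] were 0, the basis would be the initial one, of entry sum 2, whereas at least one step
     was made. *)
  exists a, c. split; [lia|]. split; [nia|]. intros ->.
  assert (a = 1)%Z by nia. subst a. assert (b = 0)%Z by lia. subst b.
  assert (d * d = 1)%Z by (apply (Z.mul_reg_l _ _ k); lia).
  assert (d = 1)%Z by nia. lia.
Qed.

(** * Arithmetic in the quadratic field, at both roots simultaneously *)

Section Quadratic.

Context (k : Z) (Hk : nonsquare k).

Lemma linear_neq0 (r : R) (p q : Z) :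
  r * r = IZR k -> (p <> 0 \/ q <> 0)%Z -> IZR p + IZR q * r <> 0.
Proof.
  intros Hr Hpq H.
  assert (E : (p * p = k * (q * q))%Z).
  { apply eq_IZR. rewrite !mult_IZR, <- Hr.
    replace (IZR p) with (- (IZR q * r)) by lra. ring. }
  pose proof (Hk p q E). nia.
Qed.

(** An element of [Q(sqrt k)] seen through both of its real embeddings: the same [a] and [b] serve
    for [sqrt k] and for [- sqrt k]. *)
Definition quadratic (f : R -> R) : Prop :=
  exists a b, rational a /\ rational b /\ forall r, r * r = IZR k -> f r = a + b * r.

Lemma quadratic_ext (f g : R -> R) :
  (forall r, r * r = IZR k -> f r = g r) -> quadratic f -> quadratic g.
Proof.
  intros H [a [b [Ha [Hb Hf]]]]. exists a, b. repeat split; auto.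
  intros r Hr. rewrite <- H by exact Hr. now apply Hf.
Qed.

Lemma quadratic_const (a : R) : rational a -> quadratic (fun _ => a).
Proof.
  intros Ha. exists a, 0. split; [exact Ha|]. split; [apply rational_IZR|]. intros. ring.
Qed.

Lemma quadratic_linear (p q : Z) : quadratic (fun r => IZR p * r + IZR q).
Proof. exists (IZR q), (IZR p). repeat split; auto with rat. intros. ring. Qed.

Lemma quadratic_plus (f g : R -> R) :
  quadratic f -> quadratic g -> quadratic (fun r => f r + g r).
Proof.
  intros [a [b [Ha [Hb Hf]]]] [a' [b' [Ha' [Hb' Hg]]]].
  exists (a + a'), (b + b'). repeat split; auto with rat.
  intros r Hr. rewrite Hf, Hg by exact Hr. ring.
Qed.

Lemma quadratic_mult (f g : R -> R) :
  quadratic f -> quadratic g -> quadratic (fun r => f r * g r).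
Proof.
  intros [a [b [Ha [Hb Hf]]]] [a' [b' [Ha' [Hb' Hg]]]].
  exists (a * a' + IZR k * (b * b')), (a * b' + b * a'). repeat split; auto with rat.
  intros r Hr. rewrite Hf, Hg, <- Hr by exact Hr. ring.
Qed.

Lemma rational_fraction (x : R) : rational x -> exists p q : Z, (0 < q)%Z /\ x = IZR p / IZR q.
Proof. intros [[p q] ->]. exists p, (Zpos q). split; [lia|reflexivity]. Qed.

Lemma quadratic_norm_neq0 (a b : R) :
  rational a -> rational b -> (a <> 0 \/ b <> 0) -> a * a - IZR k * (b * b) <> 0.
Proof.
  intros Ha Hb Hab H.
  destruct (rational_fraction a Ha) as [p [q [Hq ->]]].
  destruct (rational_fraction b Hb) as [p' [q' [Hq' ->]]].
  pose proof (IZR_lt 0 q Hq) as Hqr. pose proof (IZR_lt 0 q' Hq') as Hqr'.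
  assert (E : ((p * q') * (p * q') = k * ((p' * q) * (p' * q)))%Z).
  { apply eq_IZR. rewrite !mult_IZR.
    apply (f_equal (fun t => t * (IZR q * IZR q * (IZR q' * IZR q')))) in H.
    field_simplify in H; lra. }
  pose proof (Hk _ _ E) as H0. assert (p' = 0)%Z by nia. subst p'.
  assert (p = 0)%Z by nia. subst p. unfold Rdiv in Hab. rewrite !Rmult_0_l in Hab. tauto.
Qed.

Lemma quadratic_inv (f : R -> R) : quadratic f -> quadratic (fun r => / f r).
Proof.
  intros [a [b [Ha [Hb Hf]]]].
  destruct (classic (a <> 0 \/ b <> 0)) as [Hab|Hab].
  - pose proof (quadratic_norm_neq0 a b Ha Hb Hab) as HN.
    set (N := a * a - IZR k * (b * b)) in *.
    exists (a / N), (- b / N). assert (rational N) by (unfold N; auto 8 with rat).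
    repeat split; auto with rat.
    intros r Hr. rewrite Hf by exact Hr.
    assert (HN' : (a + b * r) * (a - b * r) = N) by (unfold N; rewrite <- Hr; ring).
    assert (a + b * r <> 0).
    { intros H0. apply HN. rewrite <- HN', H0. ring. }
    apply (Rmult_eq_reg_l (a + b * r)); [|assumption]. rewrite Rinv_r by assumption.
    replace ((a + b * r) * (a / N + - b / N * r)) with ((a + b * r) * (a - b * r) / N)
      by (field; exact HN).
    rewrite HN'. field. exact HN.
  (* Here [f] vanishes at both roots and so does its inverse, by the convention [/ 0 = 0]. *)
  - apply (quadratic_ext (fun _ => 0)); [|apply quadratic_const, rational_IZR].
    intros r Hr. rewrite Hf by exact Hr.
    assert (a = 0) as -> by (apply NNPP; tauto). assert (b = 0) as -> by (apply NNPP; tauto).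
    rewrite Rmult_0_l, Rplus_0_l, Rinv_0. reflexivity.
Qed.

Lemma quadratic_pow (f : R -> R) (n : nat) : quadratic f -> quadratic (fun r => f r ^ n).
Proof.
  intros Hf. induction n as [|n IH]; simpl.
  - apply quadratic_const, rational_IZR.
  - now apply quadratic_mult.
Qed.

Lemma quadratic_psum (f : nat -> R -> R) (N : nat) :
  (forall n, quadratic (f n)) -> quadratic (fun r => psum (fun n => f n r) N).
Proof.
  intros Hf. induction N as [|N IH]; cbn [psum].
  - apply quadratic_const, rational_IZR.
  - now apply quadratic_plus.
Qed.

Definition mobius (a b c d : Z) (r : R) : R := (IZR a * r + IZR b) / (IZR c * r + IZR d).

Lemma linear_neq0_r (r : R) (p q : Z) :
  r * r = IZR k -> (p <> 0 \/ q <> 0)%Z -> IZR p * r + IZR q <> 0.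
Proof. intros Hr Hpq. rewrite Rplus_comm. apply linear_neq0; tauto. Qed.

Lemma linear_lower_bound (r : R) (p q : Z) :
  r * r = IZR k -> (p <> 0 \/ q <> 0)%Z -> 1 <= Rabs (IZR p + IZR q * r) * Rabs (IZR p - IZR q * r).
Proof.
  intros Hr Hpq. rewrite <- Rabs_mult.
  replace ((IZR p + IZR q * r) * (IZR p - IZR q * r)) with (IZR (p * p - k * (q * q))).
  2: { rewrite minus_IZR, !mult_IZR, <- Hr. ring. }
  rewrite <- abs_IZR. apply IZR_le.
  assert (p * p <> k * (q * q))%Z; [|lia].
  intros E. pose proof (Hk p q E). nia.
Qed.

(** Liouville's argument: [(u - v x) w] is an integral element [p + q r], its norm is a nonzero
    integer, and its conjugate is at most [C |v|] once [|u - v x| <= 1]. *)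
Lemma badly_approximable_mobius (a b c d : Z) (r : R) :
  r * r = IZR k -> (a * d - b * c <> 0)%Z -> badly_approximable (mobius a b c d r).
Proof.
  intros Hr Hdet. set (x := mobius a b c d r). set (w := IZR c * r + IZR d).
  assert (Hw : w <> 0) by (apply linear_neq0_r; [exact Hr|nia]).
  assert (Hxw : x * w = IZR a * r + IZR b) by (unfold x, mobius; fold w; field; exact Hw).
  pose proof (Rabs_pos_lt w Hw) as Hwp.
  set (C := (1 + Rabs x) * Rabs (IZR d - IZR c * r) + Rabs (IZR b - IZR a * r) + 1).
  assert (HC : 1 <= C).
  { pose proof (Rabs_pos x). pose proof (Rabs_pos (IZR d - IZR c * r)).
    pose proof (Rabs_pos (IZR b - IZR a * r)). unfold C. nra. }
  assert (HCw : 0 < / (C * Rabs w)) by (apply Rinv_0_lt_compat; nra).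
  (* The bound 1 takes care of the case [|u - v x| > 1]. *)
  exists (Rmin 1 (/ (C * Rabs w))). split; [apply Rmin_pos; lra|].
  intros u v Hv.
  assert (Hv1 : 1 <= Rabs (IZR v)) by (rewrite <- abs_IZR; apply IZR_le; lia).
  destruct (Rle_dec (Rabs (IZR u - IZR v * x)) 1) as [Hle|Hgt].
  2: { apply Rle_trans with 1; [|lra]. apply Rle_div_l; [lra|].
       pose proof (Rmin_l 1 (/ (C * Rabs w))). lra. }
  set (p := (u * d - v * b)%Z). set (q := (u * c - v * a)%Z).
  assert (Hpq : (p <> 0 \/ q <> 0)%Z).
  { unfold p, q. destruct (Z.eq_dec (u * d - v * b) 0) as [Hp|Hp]; [right|left; assumption].
    intros Hq. assert (E : (v * (a * d - b * c) = 0)%Z).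
    { replace (v * (a * d - b * c))%Z with ((u * d - v * b) * c - (u * c - v * a) * d)%Z by ring.
      rewrite Hp, Hq. ring. }
    apply Z.mul_eq_0 in E. tauto. }
  pose proof (linear_lower_bound r p q Hr Hpq) as Hlb.
  assert (E1 : IZR p + IZR q * r = (IZR u - IZR v * x) * w).
  { replace ((IZR u - IZR v * x) * w) with (IZR u * w - IZR v * (x * w)) by ring.
    rewrite Hxw. unfold p, q, w. rewrite !minus_IZR, !mult_IZR. ring. }
  assert (E2 : Rabs (IZR p - IZR q * r) <= C * Rabs (IZR v)).
  { replace (IZR p - IZR q * r) with (IZR u * (IZR d - IZR c * r) - IZR v * (IZR b - IZR a * r)).
    2: { unfold p, q. rewrite !minus_IZR, !mult_IZR. ring. }
    assert (Hu : Rabs (IZR u) <= Rabs (IZR v) * (1 + Rabs x)).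
    { replace (IZR u) with ((IZR u - IZR v * x) + IZR v * x) by ring.
      eapply Rle_trans; [apply Rabs_triang|]. rewrite Rabs_mult. lra. }
    unfold Rminus at 1. eapply Rle_trans; [apply Rabs_triang|].
    rewrite Rabs_Ropp, !Rabs_mult. unfold C.
    pose proof (Rabs_pos (IZR d - IZR c * r)). pose proof (Rabs_pos (IZR b - IZR a * r)).
    nra. }
  rewrite E1, Rabs_mult in Hlb.
  apply Rle_trans with (/ (C * Rabs w) / Rabs (IZR v)).
  - apply Rmult_le_compat_r; [left; apply Rinv_0_lt_compat; lra|apply Rmin_r].
  - set (t := Rabs (IZR u - IZR v * x)) in *.
    assert (Ht : 0 <= t) by apply Rabs_pos.
    replace (/ (C * Rabs w) / Rabs (IZR v)) with (1 / (C * Rabs (IZR v) * Rabs w)) by (field; lra).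
    apply Rle_div_l; [apply Rmult_lt_0_compat; [nra|exact Hwp]|].
    eapply Rle_trans; [exact Hlb|].
    replace (t * (C * Rabs (IZR v) * Rabs w)) with (t * Rabs w * (C * Rabs (IZR v))) by ring.
    apply Rmult_le_compat_l; [nra|exact E2].
Qed.

End Quadratic.

(** * Quasi-modularity and evaluation at square roots *)

Lemma psi_opp (s : nat) (x : R) : psi s (- x) = psi s x.
Proof.
  apply Series_ext. intros n. unfold psi_term, sec.
  replace (PI * INR (S n) * - x) with (- (PI * INR (S n) * x)) by ring.
  now rewrite cos_neg.
Qed.

Lemma psi_sign (s : nat) (e : Z) (x : R) : (e = 1 \/ e = -1)%Z -> psi s (IZR e * x) = psi s x.
Proof.
  intros [-> | ->]; [now rewrite Rmult_1_l|].
  replace (-1 * x) with (- x) by ring. apply psi_opp.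
Qed.

Lemma cos_add_2PI_Z (x : R) (j : Z) : cos (x + 2 * (IZR j * PI)) = cos x.
Proof.
  assert (H : sin (IZR j * PI) = 0) by (apply sin_eq_0_1; now exists j).
  rewrite cos_plus, cos_2a_sin, sin_2a, H. ring.
Qed.

Lemma psi_add_even (s : nat) (x : R) (j : Z) : psi s (x + IZR (2 * j)) = psi s x.
Proof.
  apply Series_ext. intros n. unfold psi_term, sec.
  replace (PI * INR (S n) * (x + IZR (2 * j)))
    with (PI * INR (S n) * x + 2 * (IZR (Z.of_nat (S n) * j) * PI)).
  2: { rewrite !mult_IZR, <- INR_IZR_INZ. ring. }
  now rewrite cos_add_2PI_Z.
Qed.

Lemma badly_approximable_irrational (x : R) : badly_approximable x -> irrational x.
Proof.
  intros [c [Hc H]] u v Hv E. specialize (H u v Hv).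
  rewrite E, Rminus_diag, Rabs_R0 in H.
  assert (0 < Rabs (IZR v)) by (apply Rabs_pos_lt, eq_IZR_contrapositive; exact Hv).
  assert (0 < c / Rabs (IZR v)) by (apply Rdiv_lt_0_compat; assumption). lra.
Qed.

Lemma ex_series_psi_term (x : R) (m : nat) :
  (1 <= m)%nat -> badly_approximable x -> ex_series (fun n => Rabs (psi_term (2 * m) x n)).
Proof. intros Hm Hx. apply ex_series_psi_term_Rabs; [lia|now apply sec_sum_bound]. Qed.

Section Modular.

Context (k : Z) (Hk : nonsquare k) (m : nat) (Hm : (1 <= m)%nat).

(* [w ^ (2 m - 1)], where [w = c r + d] *)
Definition automorphy (c d : Z) (r : R) : R :=
  (IZR c * r + IZR d) ^ (2 * m) * / (IZR c * r + IZR d).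

(** The transformation law at the two roots only, with an error term in the field. The sign [e] is
    needed because the weight factor is an odd power, equal to -1 at minus the identity. *)
Definition quasi_modular (a b c d : Z) : Prop :=
  exists (e : R) (f : R -> R), (e = 1 \/ e = -1) /\ quadratic k f /\
  forall r, r * r = IZR k ->
    automorphy c d r * psi (2 * m) (mobius a b c d r) = e * psi (2 * m) r + PI ^ (2 * m) * f r.

Lemma quadratic_mobius (a b c d : Z) : quadratic k (mobius a b c d).
Proof.
  apply quadratic_mult; [apply quadratic_linear|].
  apply (quadratic_inv k Hk), quadratic_linear.
Qed.

Lemma quadratic_automorphy (c d : Z) : quadratic k (automorphy c d).
Proof.
  apply quadratic_mult; [apply quadratic_pow, quadratic_linear|].
  apply (quadratic_inv k Hk), quadratic_linear.
Qed.

Lemma quasi_modular_translate (a b c d e : Z) :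
  (a * d - b * c = 1)%Z -> quasi_modular a b c d ->
  quasi_modular (a + 2 * e * c) (b + 2 * e * d) c d.
Proof.
  intros Hdet [s [f [Hs [Hf H]]]]. exists s, f. split; [exact Hs|]. split; [exact Hf|].
  intros r Hr. rewrite <- H by exact Hr. f_equal.
  rewrite <- (psi_add_even _ (mobius a b c d r) e). f_equal.
  assert (IZR c * r + IZR d <> 0) by (apply (linear_neq0_r k Hk); [exact Hr|nia]).
  unfold mobius. rewrite !plus_IZR, !mult_IZR. field. assumption.
Qed.

(** The functional equation at [y = w' / w], the quotient of the new and old denominators: its two
    arguments are the old and new images up to the signs [e] and [- e], which the evenness of [psi]
    removes, and the automorphy factors multiply. *)
Lemma quasi_modular_shear (a b c d e : Z) :
  (e = 1 \/ e = -1)%Z -> (a * d - b * c = 1)%Z -> quasi_modular a b c d ->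
  quasi_modular a b (c + 2 * e * a) (d + 2 * e * b).
Proof.
  intros He Hdet [s [f [Hs [Hf H]]]].
  destruct (psi_functional_equation m Hm) as [q [coef [Hq [Hcoef HFE]]]].
  set (c' := (c + 2 * e * a)%Z). set (d' := (d + 2 * e * b)%Z).
  assert (Hdet' : (a * d' - b * c' = 1)%Z) by (unfold c', d'; nia).
  set (y := mobius c' d' c d).
  set (g := fun r => q * (y r ^ (2 * m) + -1 * / y r) +
    psum (fun i => coef i * y r ^ (i - 1)) (2 * m)).
  exists s, (fun r => f r + automorphy c d r * g r). split; [exact Hs|]. split.
  - assert (Hy : quadratic k y) by apply quadratic_mobius.
    apply quadratic_plus; [exact Hf|].
    apply quadratic_mult; [apply quadratic_automorphy|].
    apply quadratic_plus.
    + apply quadratic_mult; [now apply quadratic_const|].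
      apply quadratic_plus; [now apply quadratic_pow|].
      apply quadratic_mult; [apply quadratic_const, rational_IZR|now apply quadratic_inv].
    + apply (quadratic_psum k (fun i r => coef i * y r ^ (i - 1))). intros i.
      apply quadratic_mult; [now apply quadratic_const|now apply quadratic_pow].
  - intros r Hr. specialize (H r Hr).
    set (w := IZR c * r + IZR d). set (w' := IZR c' * r + IZR d').
    assert (Hw : w <> 0) by (apply (linear_neq0_r k Hk); [exact Hr|nia]).
    assert (Hw' : w' <> 0) by (apply (linear_neq0_r k Hk); [exact Hr|nia]).
    assert (Hyr : y r = w' / w) by reflexivity.
    assert (Hw'E : w' = w + 2 * IZR e * (IZR a * r + IZR b)).
    { unfold w', w, c', d'. rewrite !plus_IZR, !mult_IZR. ring. }
    assert (Hy1 : (y r - 1) / 2 = IZR e * mobius a b c d r).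
    { rewrite Hyr, Hw'E. unfold mobius. fold w. field. exact Hw. }
    assert (Hy2 : (/ y r - 1) / 2 = IZR (- e) * mobius a b c' d' r).
    { rewrite Hyr. unfold mobius. fold w'. rewrite opp_IZR.
      replace w with (w' - 2 * IZR e * (IZR a * r + IZR b)) by (rewrite Hw'E; ring).
      field. split; [exact Hw'|]. rewrite Hw'E.
      replace (w + 2 * IZR e * (IZR a * r + IZR b) - 2 * IZR e * (IZR a * r + IZR b)) with w by ring.
      exact Hw. }
    assert (Hscale : forall e' a1 b1 c1 d1, IZR e' * mobius a1 b1 c1 d1 r =
      mobius (e' * a1) (e' * b1) c1 d1 r).
    { intros. unfold mobius. rewrite !mult_IZR. unfold Rdiv. ring. }
    assert (Hinv : / y r = mobius c d c' d' r).
    { rewrite Hyr. unfold mobius. fold w w'. field. split; assumption. }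
    assert (HE : y r ^ (2 * m) * / y r * psi (2 * m) ((/ y r - 1) / 2) -
      psi (2 * m) ((y r - 1) / 2) = PI ^ (2 * m) * g r).
    { unfold g. rewrite HFE; [ring| | | |].
      - apply badly_approximable_irrational, (badly_approximable_mobius k Hk); [exact Hr|].
        unfold c', d'. nia.
      - rewrite Hinv. apply badly_approximable_irrational, (badly_approximable_mobius k Hk); [exact Hr|].
        unfold c', d'. nia.
      - apply ex_series_psi_term; [exact Hm|]. rewrite Hy1, Hscale.
        apply (badly_approximable_mobius k Hk); [exact Hr|]. nia.
      - apply ex_series_psi_term; [exact Hm|]. rewrite Hy2, Hscale.
        apply (badly_approximable_mobius k Hk); [exact Hr|]. nia. }
    rewrite Hy1, Hy2, (psi_sign _ e) in HE by exact He.
    rewrite (psi_sign _ (- e)) in HE by (destruct He; [right|left]; lia).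
    assert (HA : automorphy c' d' r = automorphy c d r * (y r ^ (2 * m) * / y r)).
    { rewrite Hyr. unfold automorphy. fold w w'. unfold Rdiv.
      rewrite Rpow_mult_distr, pow_inv. field. repeat split; try assumption.
      now apply pow_nonzero. }
    rewrite HA.
    replace (automorphy c d r * (y r ^ (2 * m) * / y r) * psi (2 * m) (mobius a b c' d' r))
      with (automorphy c d r * psi (2 * m) (mobius a b c d r) +
            automorphy c d r * (PI ^ (2 * m) * g r)) by (rewrite <- HE; ring).
    rewrite H. ring.
Qed.

(* Euclid's algorithm on the column [(a, c)]: an odd and an even entry have distinct absolute
   values, so adding twice the smaller one to the larger one, with a sign, decreases it. *)
Lemma quasi_modular_Gamma2 (a b c d : Z) :
  Z.Odd a -> Z.Even b -> Z.Even c -> (a * d - b * c = 1)%Z -> quasi_modular a b c d.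
Proof.
  assert (Hind : forall n a b c d, (Z.abs a + Z.abs c <= n)%Z ->
    Z.Odd a -> Z.Even b -> Z.Even c -> (a * d - b * c = 1)%Z -> quasi_modular a b c d).
  2: { intros. now apply (Hind (Z.abs a + Z.abs c)%Z). }
  clear a b c d. intros n. destruct (Z.lt_ge_cases n 0) as [Hn|Hn]; [intros; lia|].
  pattern n. apply natlike_ind; [| |exact Hn].
  { intros a b c d Hac [a' Ha']. lia. }
  clear n Hn. intros n Hn IH a b c d Hac Ha Hb Hc Hdet.
  destruct (Z.eq_dec c 0) as [Hc0|Hc0].
  - subst c. assert (Had : (a = 1 /\ d = 1 \/ a = -1 /\ d = -1)%Z).
    { assert (E : (a * d = 1)%Z) by lia. pose proof (Z.eq_mul_1 a d E) as [-> | ->]; lia. }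
    destruct Hb as [b' ->].
    exists (IZR d), (fun _ => 0). split; [|split].
    + destruct Had as [[_ ->]|[_ ->]]; [left|right]; reflexivity.
    + apply quadratic_const, rational_IZR.
    + intros r Hr. rewrite Rmult_0_r, Rplus_0_r.
      rewrite <- (psi_add_even _ r (a * b')%Z).
      unfold automorphy, mobius. rewrite Rmult_0_l, Rplus_0_l.
      assert (HdM : IZR d ^ (2 * m) = 1).
      { rewrite pow_mult. destruct Had as [[_ ->]|[_ ->]]; simpl (_ ^ 2).
        - replace (1 * (1 * 1)) with 1 by ring. apply pow1.
        - replace (-1 * (-1 * 1)) with 1 by ring. apply pow1. }
      rewrite HdM.
      replace ((IZR a * r + IZR (2 * b')) / IZR d) with (r + IZR (2 * (a * b'))).
      2: { rewrite !mult_IZR. destruct Had as [[-> ->]|[-> ->]]; field. }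
      destruct Had as [[_ ->]|[_ ->]]; field.
  - assert (Hsign : forall u v : Z, (0 < Z.abs v < Z.abs u)%Z -> exists e : Z,
      (e = 1 \/ e = -1)%Z /\ (Z.abs (u - 2 * e * v) < Z.abs u)%Z).
    { intros u v Huv. destruct (Z.lt_ge_cases (Z.abs (u - 2 * v)) (Z.abs u)).
      - exists 1%Z. lia.
      - exists (-1)%Z. lia. }
    destruct (Z.lt_ge_cases (Z.abs c) (Z.abs a)) as [Hlt|Hge].
    + destruct (Hsign a c ltac:(lia)) as [e [He Hdec]].
      replace a with ((a - 2 * e * c) + 2 * e * c)%Z by ring.
      replace b with ((b - 2 * e * d) + 2 * e * d)%Z by ring.
      apply quasi_modular_translate; [nia|]. apply IH; [lia| | |exact Hc|nia].
      * destruct Ha as [a' ->]. exists (a' - e * c)%Z. ring.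
      * destruct Hb as [b' ->]. exists (b' - e * d)%Z. ring.
    + assert (Hlt : (0 < Z.abs a < Z.abs c)%Z).
      { destruct Ha as [a' ->], Hc as [c' ->]. lia. }
      destruct (Hsign c a Hlt) as [e [He Hdec]].
      replace c with ((c - 2 * e * a) + 2 * e * a)%Z by ring.
      replace d with ((d - 2 * e * b) + 2 * e * b)%Z by ring.
      apply quasi_modular_shear; [exact He|nia|]. apply IH; [lia|exact Ha|exact Hb| |nia].
      destruct Hc as [c' ->]. exists (c' - e * a)%Z. ring.
Qed.

End Modular.

(** * Evaluation at the square root of a nonsquare *)

Lemma pow_eq_1_nonneg (x : R) (n : nat) : (n <> 0)%nat -> 0 <= x -> x ^ n = 1 -> x = 1.
Proof.
  intros Hn Hx H. destruct (Rtotal_order x 1) as [Hlt|[Heq|Hgt]]; [|exact Heq|].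
  - destruct n as [|n]; [lia|].
    assert (x ^ S n <= x); [|lra]. simpl.
    assert (x ^ n <= 1 ^ n) by (apply pow_incr; lra). rewrite pow1 in *.
    nra.
  - pose proof (Rlt_pow_R1 x n Hgt ltac:(lia)). lra.
Qed.

Lemma psi_sqrt_nonsquare (k : Z) (m : nat) :
  (0 < k)%Z -> nonsquare k -> (1 <= m)%nat ->
  exists x, rational x /\ psi (2 * m) (sqrt (IZR k)) = PI ^ (2 * m) * x.
Proof.
  intros Hk0 Hk Hm. destruct (pell k Hk0 Hk) as [a0 [c0 [HP [Ha0 Hc0]]]].
  (* [X + Y r] is [(a0 + c0 r)^2], rewritten with the Pell equation; squaring makes [X] odd and [Y]
     even. The matrix of multiplication by this unit fixes both roots. *)
  set (X := (1 + 2 * (k * (c0 * c0)))%Z). set (Y := (2 * (a0 * c0))%Z).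
  assert (HXY : (X * X - k * Y * Y = 1)%Z) by (unfold X, Y; nia).
  assert (HY0 : (Y <> 0)%Z) by (unfold Y; nia).
  destruct (quasi_modular_Gamma2 k Hk m Hm X (k * Y) Y X) as [e [f [He [Hf H]]]].
  { exists (k * (c0 * c0))%Z. unfold X. ring. }
  { exists (k * (a0 * c0))%Z. unfold Y. ring. }
  { exists (a0 * c0)%Z. reflexivity. }
  { exact HXY. }
  (* If the factor [w ^ (2 m - 1)] were [e], then [w^2] would be 1; as [w] has norm 1, it would
     equal its conjugate, against [Y r <> 0]. *)
  assert (Hfix : forall r, r * r = IZR k -> r <> 0 /\ mobius X (k * Y) Y X r = r /\
    automorphy m Y X r - e <> 0).
  { intros r Hr.
    assert (Hw : IZR Y * r + IZR X <> 0) by (apply (linear_neq0_r k Hk); [exact Hr|lia]).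
    assert (Hr0 : r <> 0).
    { intros ->. rewrite Rmult_0_l in Hr. apply eq_IZR in Hr. lia. }
    split; [exact Hr0|]. split.
    - unfold mobius. rewrite mult_IZR, <- Hr. field. exact Hw.
    - unfold automorphy. set (w := IZR Y * r + IZR X) in *. intros Hauto.
      assert (Hpow : w ^ (2 * m) = e * w).
      { apply (Rmult_eq_reg_r (/ w)); [|now apply Rinv_neq_0_compat].
        rewrite Rmult_assoc, Rinv_r by exact Hw. lra. }
      assert (Hw2 : (w * w) ^ (2 * m - 1) = 1).
      { apply (Rmult_eq_reg_r (w * w)); [|nra].
        replace ((w * w) ^ (2 * m - 1) * (w * w)) with ((w * w) ^ (2 * m)).
        2: { rewrite <- (pow_1 (w * w)) at 3. rewrite <- pow_add. f_equal. lia. }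
        rewrite Rpow_mult_distr, Hpow. destruct He as [-> | ->]; ring. }
      apply pow_eq_1_nonneg in Hw2; [|lia|nra].
      assert (Hnorm : w * (IZR X - IZR Y * r) = 1).
      { replace (w * (IZR X - IZR Y * r)) with (IZR (X * X - k * Y * Y)).
        2: { unfold w. rewrite minus_IZR, !mult_IZR, <- Hr. ring. }
        now rewrite HXY. }
      assert (HYr : w * (2 * (IZR Y * r)) = 0).
      { replace (2 * (IZR Y * r)) with (w - (IZR X - IZR Y * r)) by (unfold w; ring). lra. }
      apply Rmult_integral in HYr. destruct HYr as [HYr|HYr]; [now apply Hw|].
      assert (IZR Y <> 0) by (apply eq_IZR_contrapositive; exact HY0).
      assert (IZR Y * r <> 0) by (now apply Rmult_integral_contrapositive). lra. }
  assert (Hq : quadratic k (fun r => f r * / (automorphy m Y X r + - e))).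
  { apply quadratic_mult; [exact Hf|]. apply (quadratic_inv k Hk).
    apply quadratic_plus; [now apply quadratic_automorphy|]. apply quadratic_const.
    destruct He as [-> | ->]; auto with rat. }
  destruct Hq as [x [y [Hx [Hy Hq]]]].
  assert (Hval : forall r, r * r = IZR k -> psi (2 * m) r = PI ^ (2 * m) * (x + y * r)).
  { intros r Hr. destruct (Hfix r Hr) as [_ [Hmob Hne]]. specialize (H r Hr). rewrite Hmob in H.
    rewrite <- Hq by exact Hr. apply (Rmult_eq_reg_l (automorphy m Y X r - e)); [|exact Hne].
    rewrite Rmult_minus_distr_r, H. field. exact Hne. }
  assert (Hsq : sqrt (IZR k) * sqrt (IZR k) = IZR k) by (apply sqrt_sqrt, IZR_le; lia).
  exists x. split; [exact Hx|].
  (* Averaging the values at the two roots, equal by evenness, eliminates [y]. *)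
  pose proof (Hval _ Hsq) as E1.
  pose proof (Hval (- sqrt (IZR k)) ltac:(rewrite Rmult_opp_opp; exact Hsq)) as E2.
  rewrite psi_opp in E2. nra.
Qed.

(** * Integer arguments: zeta and alternating zeta values *)

Lemma cos_INR_PI (n : nat) : cos (INR n * PI) = (-1) ^ n.
Proof.
  induction n as [|n IH]; [simpl; now rewrite Rmult_0_l, cos_0|].
  rewrite S_INR, Rmult_plus_distr_r, Rmult_1_l, neg_cos, IH. simpl. ring.
Qed.

(** The cosine sum over the even class [p = 2 l], freed of its factor [(1 / 2) ^ (2 i + 2)]. *)
Lemma alternating_zeta_even (i : nat) :
  pi_rational_lim (2 * i + 2) (psum (fun n => (-1) ^ n * (/ INR n) ^ (2 * i + 2))).
Proof.
  assert (Hr : rational ((/ 2) ^ (2 * i + 2))) by auto with rat.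
  assert (H2 : (/ 2) ^ (2 * i + 2) <> 0) by (apply pow_nonzero; lra).
  apply (pi_rational_lim_cancel _ 0 _ _ Hr H2). rewrite Nat.add_0_r.
  eapply pi_rational_lim_ext; [|apply (class_cos_sum_lim 0 (Nat.le_0_l 1) i)].
  intros L. cbv beta. rewrite <- psum_scal. apply psum_ext. intros l _.
  simpl (INR 0). rewrite !Rminus_0_r.
  replace (2 * INR l * (PI / 2)) with (INR l * PI) by field.
  rewrite cos_INR_PI, Rinv_mult, Rpow_mult_distr. simpl (PI ^ 0). ring.
Qed.

Lemma sec_integer (n l : nat) : sec (PI * INR n * INR l) = (-1) ^ (n * l).
Proof.
  unfold sec. replace (PI * INR n * INR l) with (INR (n * l) * PI) by (rewrite mult_INR; ring).
  rewrite cos_INR_PI, <- pow_inv. f_equal. field.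
Qed.

Lemma ex_series_psi_term_integer (s l : nat) :
  (2 <= s)%nat -> ex_series (fun n => Rabs (psi_term s (INR l) n)).
Proof.
  intros Hs. apply ex_series_psi_term_Rabs; [exact Hs|]. exists 1. intros N.
  rewrite (psum_ext _ (fun _ => 1)).
  2: { intros n _. rewrite sec_integer. apply pow_1_abs. }
  assert (H : psum (fun _ => 1) N = INR N).
  { induction N as [|N IH]; [reflexivity|]. cbn [psum]. now rewrite IH, S_INR. }
  rewrite H. destruct N as [|N]; [simpl; lra|].
  assert (1 <= INR (S N)) by (apply (le_INR 1); lia).
  assert (1 <= sqrt (INR (S N))) by (rewrite <- sqrt_1; apply sqrt_le_1; lra). nra.
Qed.

Lemma psi_integer_lim (s l : nat) :
  (2 <= s)%nat ->
  is_lim_seq (psum (fun n => (-1) ^ (n * l) * (/ INR n) ^ s)) (psi s (INR l)).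
Proof.
  intros Hs. apply is_series_psum. unfold psi.
  eapply is_series_ext; [|apply Series_correct, ex_series_Rabs, ex_series_psi_term_integer; exact Hs].
  intros n. unfold psi_term. rewrite sec_integer, pow_inv. reflexivity.
Qed.

Lemma psi_integer_odd (i l : nat) :
  Nat.Odd l -> exists x, rational x /\ psi (2 * i + 2) (INR l) = PI ^ (2 * i + 2) * x.
Proof.
  intros [l' ->]. destruct (alternating_zeta_even i) as [x [Hx Hlim]].
  exists x. split; [exact Hx|].
  pose proof (psi_integer_lim (2 * i + 2) (2 * l' + 1) ltac:(lia)) as H.
  apply is_lim_seq_unique in H.
  eapply is_lim_seq_ext in Hlim; [apply is_lim_seq_unique in Hlim; rewrite Hlim in H; now injection H|].
  intros N. apply psum_ext. intros n _. f_equal.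
  replace (n * (2 * l' + 1))%nat with (2 * (n * l') + n)%nat by ring.
  rewrite pow_add, pow_1_even. ring.
Qed.

(** The value is a zeta value. Adding the alternating series kills the odd terms and doubles the
    even ones, so that the sum is [2 / 2^M] times the zeta value itself. *)
Lemma psi_integer_even (i l : nat) :
  Nat.Even l -> exists x, rational x /\ psi (2 * i + 2) (INR l) = PI ^ (2 * i + 2) * x.
Proof.
  intros [l' ->]. set (M := (2 * i + 2)%nat).
  destruct (alternating_zeta_even i) as [x [Hx Halt]]. fold M in Halt.
  pose proof (psi_integer_lim M (2 * l') ltac:(unfold M; lia)) as H.
  set (z := psi M (INR (2 * l'))) in *.
  assert (Hz : is_lim_seq (psum (fun n => (/ INR n) ^ M)) z).
  { eapply is_lim_seq_ext; [|exact H]. intros N. apply psum_ext. intros n _.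
    replace (n * (2 * l'))%nat with (2 * (n * l'))%nat by ring. rewrite pow_1_even. ring. }
  set (h := (/ 2) ^ M).
  assert (Hh : 2 * h - 1 <> 0).
  { assert ((/ 2) ^ (2 * i) <= 1 ^ (2 * i)) by (apply pow_incr; lra).
    rewrite pow1 in *. unfold h, M. rewrite pow_add. simpl ((/ 2) ^ 2). lra. }
  assert (E : PI ^ M * x + z = 2 * h * z).
  { pose proof (is_lim_seq_plus' _ _ _ _ (is_lim_seq_double _ _ Halt) (is_lim_seq_double _ _ Hz)) as H1.
    pose proof (is_lim_seq_scal_l _ (2 * h) z Hz) as H2.
    eapply is_lim_seq_ext in H1.
    - apply is_lim_seq_unique in H1. apply is_lim_seq_unique in H2. rewrite H1 in H2.
      now injection H2.
    - intros L. rewrite !psum_pairs, <- psum_scal, <- !psum_plus.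
      apply psum_ext. intros n Hn. rewrite pow_1_even.
      replace (2 * n - 1)%nat with (S (2 * (n - 1))) at 1 by lia. rewrite pow_1_odd.
      rewrite (mult_INR 2 n), Rinv_mult, Rpow_mult_distr. change (INR 2) with 2. fold h. ring. }
  exists (x / (2 * h - 1)). split; [unfold h; auto 8 with rat|].
  apply (Rmult_eq_reg_l (2 * h - 1)); [|exact Hh].
  replace ((2 * h - 1) * (PI ^ M * (x / (2 * h - 1)))) with (PI ^ M * x) by (field; exact Hh).
  fold z. lra.
Qed.

Theorem theorem2 (m k : nat) (hm : (1 <= m)%nat) (hk : (1 <= k)%nat) :
  ex_series (psi_term (2 * m) (sqrt (INR k))) /\
  exists q : Q, psi (2 * m) (sqrt (INR k)) = PI ^ (2 * m) * Q2R q.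
Proof.
  enough (H : ex_series (fun n => Rabs (psi_term (2 * m) (sqrt (INR k)) n)) /\
    exists x, rational x /\ psi (2 * m) (sqrt (INR k)) = PI ^ (2 * m) * x).
  { destruct H as [H1 [x [[q ->] H2]]]. split; [now apply ex_series_Rabs|now exists q]. }
  destruct (classic (exists l : nat, (l * l)%nat = k)) as [[l <-]|Hl].
  - rewrite mult_INR, sqrt_square by apply pos_INR.
    split; [apply ex_series_psi_term_integer; lia|].
    replace (2 * m)%nat with (2 * (m - 1) + 2)%nat by lia.
    destruct (Nat.Even_or_Odd l); [now apply psi_integer_even|now apply psi_integer_odd].
  - assert (Hk : nonsquare (Z.of_nat k)).
    { apply nonsquare_intro; [lia|]. intros l Hl0 E. apply Hl. exists (Z.to_nat l). nia. }
    rewrite INR_IZR_INZ. split; [|apply psi_sqrt_nonsquare; [lia|exact Hk|exact hm]].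
    apply ex_series_psi_term; [exact hm|].
    (* The identity matrix makes the approximation lemma apply to [sqrt k] itself. *)
    replace (sqrt (IZR (Z.of_nat k))) with (mobius 1 0 0 1 (sqrt (IZR (Z.of_nat k))))
      by (unfold mobius; field).
    apply (badly_approximable_mobius (Z.of_nat k) Hk); [|lia].
    apply sqrt_sqrt, IZR_le. lia.
Qed.
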